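(* Let $m,n$ be positive integers and let $K_{m,n}$ be the metric complete bipartite graph with all edge lengths equal to one. For all integers $r$ with $0<r<g(K_{m,n})=(m-1)(n-1)$, we have $d_r(K_{m,n})=\delta_r(m,n)$.
   Context: A divisor on a metric graph $\Gamma$ is a finite formal $\mathbb{Z}$-linear combination of points of $\Gamma$ (arbitrary points, not only vertices); its degree is the sum of its coefficients, and it is effective if all coefficients are $\ge 0$. A rational function on $\Gamma$ is a continuous piecewise linear function with integer slopes and finitely many pieces; its principal divisor has at each point $p$ the coefficient given by the sum of the outgoing slopes at $p$. Two divisors are linearly equivalent if they differ by a principal divisor. The rank $\mathrm{rk}_\Gamma(D)$ is $-1$ if $D$ is not equivalent to an effective divisor, and otherwise the largest integer $s\ge 0$ such that $D-E$ is equivalent to an effective divisor for every effective divisor $E$ of degree $s$ on $\Gamma$. The genus $g(\Gamma)$ is the first Betti number of $\Gamma$. The gonality sequence of $\Gamma$ is $d_r(\Gamma)=\min\{d\in\mathbb{Z}\mid \exists D\in\mathrm{Div}(\Gamma): \deg(D)=d \text{ and } \mathrm{rk}_\Gamma(D)\ge r\}$. For $0<r<(m-1)(n-1)$, $I_r$ is the set of triples $(a,b,h)\in\mathbb{Z}^3$ with $0\le a\le m-1$, $0\le b\le n-1$, $h\ge 0$ and $r=(a+1)(b+1)-1-h$; and $\delta_r(m,n)=\min\{an+bm-h \mid (a,b,h)\in I_r\}$. *)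

(* Defs.v *)
From HB Require Import structures.
From mathcomp Require Import all_boot all_order all_algebra.
From mathcomp Require Import boolp classical_sets reals.
From mathcomp Require Import freeg.

Set Implicit Arguments.
Unset Strict Implicit.
Unset Printing Implicit Defensive.

Import Order.TTheory GRing.Theory Num.Theory.

Local Open Scope classical_set_scope.
Local Open Scope ring_scope.

(* Minimum and maximum of a set of integers.  If they are not attained the
   value is 0, resp. -1. *)
Definition zmin (A : set int) : int :=
  xget 0 [set x | A x /\ forall y, A y -> x <= y].

Definition zmax (A : set int) : int :=
  xget (-1) [set x | A x /\ forall y, A y -> y <= x].

(* A metric graph is given by a finite multigraph model with positive edge
   lengths; edge e is a copy of the interval [0, len e], with 0 glued to src e
   and len e glued to tgt e.  The choice of orientation is immaterial. *)
Record mgraph (R : realType) := MGraph {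
  vert : finType;
  edge : finType;
  src : edge -> vert;
  tgt : edge -> vert;
  len : edge -> R;
  len_gt0 : forall e, 0 < len e
}.

Section MetricGraph.
Variables (R : realType) (G : mgraph R).

(* inl v is the vertex v; inr (e, t) is the point at distance t from src e in
   the relative interior of e. *)
Definition is_point (x : vert G + edge G * R) : bool :=
  match x with
  | inl _ => true
  | inr (e, t) => 0 < t < len e
  end.

Definition point := {x : vert G + edge G * R | is_point x}.

Definition vpoint (v : vert G) : point := Sub (inl v) isT.

(* The parametrization [0, len e] -> G of the closed edge e, extended to R by
   clamping the parameter. *)
Definition epoint (e : edge G) (t : R) : point :=
  if t <= 0 then vpoint (src e)
  else if len e <= t then vpoint (tgt e)
  else insubd (vpoint (src e)) (inr (e, t)).

Definition divisor := {freeg point / int}.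

Definition effective (D : divisor) : Prop := forall p, 0 <= coeff p D.

(* On every closed edge, f is affine with integer slope on each closed piece
   [t i, t i.+1] of a finite subdivision.  Consecutive pieces share their
   breakpoints and the values at the ends of the edges are the values at the
   vertices, so such an f is continuous. *)
Definition rational_fun (f : point -> R) : Prop :=
  forall e, exists (k : nat) (t : nat -> R) (s : nat -> int),
    [/\ t 0%N = 0, t k = len e,
        forall i, (i < k)%N -> t i < t i.+1 &
        forall i x, (i < k)%N -> t i <= x <= t i.+1 ->
          f (epoint e x) = f (epoint e (t i)) + (s i)%:~R * (x - t i)].

(* Outgoing slope of f at the parameter t of e, in the direction of increasing
   parameters for u = 1 and of decreasing parameters for u = -1. *)
Definition slope (f : point -> R) (e : edge G) (t u : R) : int :=
  xget 0 [set s : int | exists eps : R, 0 < eps /\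
    forall h, 0 <= h < eps ->
      f (epoint e (t + u * h)) = f (epoint e t) + s%:~R * h].

(* Sum of the outgoing slopes of f at p; a loop at a vertex contributes two
   directions. *)
Definition slope_sum (f : point -> R) (p : point) : int :=
  match val p with
  | inl v => \sum_(e | src e == v) slope f e 0 1
             + \sum_(e | tgt e == v) slope f e (len e) (-1)
  | inr (e, t) => slope f e t 1 + slope f e t (-1)
  end.

Definition principal (D : divisor) : Prop :=
  exists f, rational_fun f /\ forall p, coeff p D = slope_sum f p.

Definition lin_equiv (D D' : divisor) : Prop := principal (D - D').

Definition equiv_effective (D : divisor) : Prop :=
  exists D', effective D' /\ lin_equiv D D'.

Definition rank (D : divisor) : int :=
  if `[< equiv_effective D >] then
    zmax [set s | 0 <= s /\
      forall E, effective E -> deg E = s -> equiv_effective (D - E)]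
  else -1.

Definition gonality (r : int) : int :=
  zmin [set d | exists D : divisor, deg D = d /\ r <= rank D].

(* First Betti number: the dimension of H_1(G; rat), which is the kernel of the
   cellular boundary map (acting on row vectors) since G is one-dimensional. *)
Definition boundary : 'M[rat]_(#|edge G|, #|vert G|) :=
  \matrix_(i, j) ((tgt (enum_val i) == enum_val j)%:R
                  - (src (enum_val i) == enum_val j)%:R).

Definition genus : nat := \rank (kermx boundary).

End MetricGraph.

Lemma unit_len_gt0 (R : realType) (E : finType) (e : E) : (0 : R) < 1.
Proof. exact: ltr01. Qed.

Definition Kmn (R : realType) (m n : nat) : mgraph R :=
  @MGraph R ('I_m + 'I_n)%type ('I_m * 'I_n)%type
    (fun e => inl e.1) (fun e => inr e.2) (fun _ => 1)
    (@unit_len_gt0 R ('I_m * 'I_n)%type).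

Definition Iset (m n : nat) (r : int) : set (int * int * int) :=
  [set x | let: (a, b, h) := x in
    [/\ 0 <= a <= m%:Z - 1, 0 <= b <= n%:Z - 1, 0 <= h &
        r = (a + 1) * (b + 1) - 1 - h]].

(* For 0 < r < (m-1)(n-1) this minimum is attained and is at least r > 0. *)
Definition delta (r : int) (m n : nat) : int :=
  zmin [set d | exists a b h : int,
    Iset m n r (a, b, h) /\ d = a * n%:Z + b * m%:Z - h].

(* Main.v *)
From mathcomp Require Import all_boot all_order all_algebra.
From mathcomp Require Import boolp classical_sets reals.
From mathcomp Require Import freeg.
From mathcomp Require Import zify ring lra.
Require Import Defs.

Set Implicit Arguments.
Unset Strict Implicit.
Unset Printing Implicit Defensive.

Import Order.TTheory GRing.Theory Num.Theory.

Local Open Scope ring_scope.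

(** The class of a divisor [D] is governed by finitely many numbers.  Give all
    interior chips of an edge to its source; this leaves an integer at each
    vertex ([vertex_degree]) and, on each edge, the real number
    [moment D e], the sum of the parameters of the chips.  Up to functions
    supported in the interior of an edge nothing else matters, and a rational
    function with values [- f v] at the vertices shifts the moment of [e] by
    [f (src e) - f (tgt e)].  Pushing the chips of every edge to its ends until
    at most one chip stays inside leaves [chip_value D f v] chips at [v], a sum
    of floors of the shifted moments.  Hence [D] is equivalent to an effective
    divisor iff some real potential [f] makes all these values nonnegative
    ([equiv_effectiveP]).

    The value at [v] can only grow when [v] is raised less than the other
    vertices.  So a potential all of whose values are negative proves that [D]
    is not equivalent to an effective divisor ([certificate_sound]), and one of
    the two kinds of potential always exists ([dichotomy]).

    Divisors of large rank.  Put [b] chips on each of the [m] left vertices and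
    [a] chips on each of the [n] right ones.  If removing an effective [E] left
    no effective divisor, there would be a negative potential [f].  Add up the
    inequalities at the [a + 1] lowest left vertices and at the right vertices
    lying below the highest of these: each edge between the two groups costs at
    most 1, each other edge nothing, and [deg E >= (a + 1) * (b + 1)] follows
    ([grid_degree]).  Thus the rank is at least [(a + 1) * (b + 1) - 1], and
    removing [h] chips lowers it by at most [h].

    Lower bound on the degree.  If [rank D >= r], every potential satisfies
    [sum_v max 0 (value v + 1) >= r + 1], since otherwise the summands define an
    effective divisor of degree [r] whose removal is obstructed
    ([rank_certificate]).  It remains to choose the potential well.
    If [K - D] is not equivalent to an effective divisor, where [K] is the
    canonical divisor, a negative potential for [K - D] becomes one for [D] with
    no value below [-1]; the sum is then [deg D - g + 1], and the triple
    with [a = m - 1], [b = n - 1] gives the bound.  Otherwise take the largest potential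
    that makes [D] effective and lies below a potential making [K - D]
    effective: no single vertex can then be fired ([no_vertex_fires]).  Breaking
    ties along a suitable order of the vertices ([bipartite_order]) gives value
    [-1] to every left vertex, while the values at the right vertices compare
    two staircases.  The excess [N] of one over the other fits into a [p] by [q]
    rectangle and the deficiency [M] into an [m - p] by [n - q] one
    ([staircase_rectangles]), because excess and deficiency never share a row or
    a column.  As [N - M = deg D - g + 1] and [N >= r + 1], the triple with
    [a = p - 1], [b = q - 1] bounds [deg D] from below. *)

(** * Potentials on a finite graph *)

Section Real.
Variable R : realType.

Lemma seq_smallness (T : eqType) (r : seq T) (P : T -> R -> Prop) :
  (forall t, t \in r -> exists2 e, 0 < e & forall d, 0 < d <= e -> P t d) ->
  exists2 e, 0 < e & forall t d, t \in r -> 0 < d <= e -> P t d.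
Proof.
elim: r => [_|a r IH small]; first by exists 1.
have [e1 e10 P1] := small a (mem_head _ _).
have [|e2 e20 P2] := IH; first by move=> t tr; apply: small; rewrite inE tr orbT.
exists (Num.min e1 e2); first by rewrite lt_min e10.
move=> t d; rewrite inE le_min => /predU1P[->|tr] /and3P[d0 d1 d2].
  by apply: P1; rewrite d0.
by apply: P2; rewrite ?d0.
Qed.

Lemma finite_smallness (T : finType) (P : T -> R -> Prop) :
  (forall t, exists2 e, 0 < e & forall d, 0 < d <= e -> P t d) ->
  exists2 e, 0 < e & forall t d, 0 < d <= e -> P t d.
Proof.
move=> small; have [//|e e0 eP] := @seq_smallness T (enum T) P.
by exists e => // t d; apply: eP; rewrite mem_enum.
Qed.

Lemma floor_perturb (x : R) (k : int) :
  exists2 e, 0 < e & forall d, 0 < d <= e ->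
    Num.floor (x + d * k%:~R) =
      if 0 <= k then Num.floor x else - Num.floor (- x) - 1.
Proof.
have [k0|k0] := leP 0 k.
  have gap : 0 < (Num.floor x + 1)%:~R - x by rewrite subr_gt0 floorD1_gt.
  have k1 : 0 < (k%:~R + 1 : R) by rewrite ltr_wpDl ?ler0z.
  exists (((Num.floor x + 1)%:~R - x) / (k%:~R + 1)); first exact: divr_gt0.
  move=> d /andP[d0]; rewrite ler_pdivlMr // => dle.
  have kR : 0 <= (k%:~R : R) by rewrite ler0z.
  apply: floor_def; have := floor_le x; move: dle; rewrite !intrD => dle fx.
  by apply/andP; split; nra.
have gap : 0 < x + (Num.floor (- x) + 1)%:~R.
  by have := floorD1_gt (- x); lra.
have k1 : 0 < (- k%:~R + 1 : R) by rewrite ltr_wpDl // oppr_ge0 lerz0 ltW.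
exists ((x + (Num.floor (- x) + 1)%:~R) / (- k%:~R + 1)); first exact: divr_gt0.
move=> d /andP[d0]; rewrite ler_pdivlMr // => dle.
have kR : (k%:~R : R) < 0 by rewrite ltrz0.
apply: floor_def; have := floor_le (- x).
move: dle; rewrite !intrD !rmorphN /= => dle fx.
by apply/andP; split; nra.
Qed.

Lemma floor_floorN (x : R) : -1 <= Num.floor x + Num.floor (- x) <= 0.
Proof.
have h1 := floor_itv x; have h2 := floor_itv (- x).
move: h1 h2; rewrite !intrD => /andP[a b] /andP[c d].
rewrite -(ler_int R) -[X in _ && X](ler_int R) !intrD.
apply/andP; split; last by lra.
rewrite -intrD ler_int -subr_ge0 opprK -ltzD1 -(ltr_int R) !intrD; lra.
Qed.

End Real.

Section Potential.
Variables (R : realType) (V : finType) (adj : rel V).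
Implicit Types (c : V -> int) (z : V -> V -> R) (f g : V -> R) (v w : V).

Definition edge_floor z f v w : int := Num.floor (z v w + f w - f v).

(** With [z] antisymmetric this is the divisor class with [c v] chips at [v] and
    moment [- z v w] on the edge from [v] to [w], in units of the edge length;
    the value counts the chips at [v] once each edge retains at most one chip
    in its interior. *)
Definition potential_value c z f v : int := c v + \sum_(w | adj v w) edge_floor z f v w.

Local Notation value := potential_value.

Definition antisym z := forall v w, z w v = - z v w.

Lemma edge_floor_rev z f v w : antisym z ->
  edge_floor z f w v = Num.floor (- (z v w + f w - f v)).
Proof. by move=> zN; rewrite /edge_floor (zN v w); congr Num.floor; ring. Qed.

Lemma edge_floor_swap z f v w : antisym z ->
  -1 <= edge_floor z f v w + edge_floor z f w v <= 0.
Proof.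
by move=> zN; rewrite (edge_floor_rev f v w zN); apply: floor_floorN.
Qed.

Lemma edge_floor_lower z f g v w :
  f v - g v <= f w - g w -> edge_floor z g v w <= edge_floor z f v w.
Proof. by move=> h; apply: le_floor; lra. Qed.

Lemma value_mono c z f g v :
  (forall w, f v - g v <= f w - g w) -> value c z g v <= value c z f v.
Proof.
by move=> h; rewrite lerD2l; apply: ler_sum => w _; apply: edge_floor_lower.
Qed.

(** Moving the vertices by infinitesimal amounts decides which end receives the
    chip of an edge whose shifted moment is an integer: an edge floor keeps its
    value when the other end moves at least as far up, and drops just below the
    ceiling otherwise. *)
Lemma perturbation z f (pos : V -> nat) : antisym z ->
  exists2 e : R, 0 < e & forall d, 0 < d <= e -> forall v w,
    edge_floor z (fun u => f u + d * (pos u)%:R) v w =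
      if (pos v <= pos w)%N then edge_floor z f v w
      else - edge_floor z f w v - 1.
Proof.
move=> zN; have [e e0 He] := @finite_smallness R (V * V)%type
  (fun p d => Num.floor (z p.1 p.2 + f p.2 - f p.1
                         + d * ((pos p.2)%:Z - (pos p.1)%:Z)%:~R)
     = if 0 <= (pos p.2)%:Z - (pos p.1)%:Z
       then Num.floor (z p.1 p.2 + f p.2 - f p.1)
       else - Num.floor (- (z p.1 p.2 + f p.2 - f p.1)) - 1)
  (fun p => floor_perturb _ _).
exists e => // d dle v w; have := He (v, w) d dle => /=.
rewrite subr_ge0 lez_nat (edge_floor_rev f v w zN) /edge_floor => <-.
by congr Num.floor; rewrite intrB; ring.
Qed.

(** The pointwise supremum works: the floor is right continuous, so the value at
    [v] does not drop in the limit when [v] rises to its supremum, and raising the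
    other vertices only helps. *)
Lemma maximal_potential c z (Z : pred V) f0 g :
  (forall v, f0 v <= g v) -> (forall v, Z v -> 0 <= value c z f0 v) ->
  exists f, [/\ forall v, f v <= g v, forall v, Z v -> 0 <= value c z f v &
    forall f', (forall v, f' v <= g v) -> (forall v, Z v -> 0 <= value c z f' v)
      -> forall v, f' v <= f v].
Proof.
move=> f0g Lf0.
pose F : set (V -> R) := [set f | (forall v, f v <= g v) /\
                   (forall v, Z v -> 0 <= value c z f v)]%classic.
pose S v : set R := [set f v | f in F]%classic.
have Ff0 : F f0 by [].
have supS v : has_sup (S v).
  by split; [exists (f0 v), f0|exists (g v) => _ [f [fg _] <-]].
have leS (f : V -> R) v : F f -> f v <= sup (S v).
  by move=> Ff; apply: (ub_le_sup (supS v).2); exists f.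
exists (fun v => sup (S v)); split.
- move=> v; apply: ge_sup; first by have [] := supS v.
  by move=> _ [f [fg _] <-].
- move=> v Zv; pose fs v : R := sup (S v).
  (* Within [e] to the right of the limit no floor at [v] jumps. *)
  have [e e0 He] := @finite_smallness R V
    (fun w d => Num.floor (z v w + fs w - fs v + d * 1%:~R)
                = Num.floor (z v w + fs w - fs v))
    (fun w => floor_perturb _ 1).
  have [_ [f Ff <-] fe] := sup_adherent e0 (supS v).
  apply: le_trans (Ff.2 v Zv) _; rewrite lerD2l; apply: ler_sum => w _.
  rewrite /edge_floor; have [fv|fv] := eqVneq (f v) (fs v).
    by apply: le_floor; have := leS f w Ff; rewrite fv /fs /=; lra.
  rewrite -(He w (fs v - f v)).
    by apply: le_floor; have := leS f w Ff; rewrite mulr1 addrA subrK lerD2r lerD2l.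
  have lt : f v < fs v by rewrite lt_neqAle fv leS.
  by apply/andP; split; move: fe; rewrite -/(fs v); lra.
- by move=> f' f'g Lf' v; apply: leS.
Qed.

(** Compare the two potentials at a vertex where [g - f] is largest. *)
Lemma certificate_sound c z f g : (0 < #|V|)%N ->
  (forall v, value c z f v <= -1) -> exists v, value c z g v <= -1.
Proof.
move=> /card_gt0P[v0 _] Lf.
have [v _ Hv] := @Order.TotalTheory.arg_maxP _ R V v0 predT (fun v => g v - f v) isT.
by exists v; apply: le_trans (Lf v); apply: value_mono => w; have /= := Hv w isT; lra.
Qed.

End Potential.

Section Ordering.
Variable V : finType.

(** A choice that is available after every proper subset yields a linear order
    in which each element is a valid choice after its predecessors; [h] is the
    position in that order. *)
Lemma greedy_ordering (P : {set V} -> pred V) :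
  (forall Q, Q != [set: V] -> exists2 v, v \notin Q & P Q v) ->
  exists2 h : V -> nat, injective h & forall v, P [set w | h w < h v]%N v.
Proof.
move=> next.
suff main k Q : #|~: Q| = k -> exists2 h : V -> nat,
    {in ~: Q &, injective h} &
    forall v, v \notin Q -> P (Q :|: [set w in ~: Q | h w < h v]%N) v.
  have [h hi hP] := main _ finset.set0 erefl; exists h.
    by move=> v w; apply: hi; rewrite !inE.
  move=> v; have := hP v; rewrite inE => /(_ isT).
  by congr (is_true (P _ _)); apply/setP => w; rewrite !inE.
elim: k Q => [|k IH] Q Qk.
  have QE v : v \in Q by move/cards0_eq/setP: Qk => /(_ v); rewrite !inE => /negbFE.
  by exists (fun=> 0%N) => [v w|v]; rewrite ?inE QE.
have [|v vQ Pv] := next Q.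
  by apply: contra_eq_neq Qk => ->; rewrite finset.setCT cards0.
have [|h hi hP] := IH (v |: Q).
  have := cardsC (v |: Q); have := cardsC Q; rewrite cardsU1 vQ Qk; lia.
exists (fun w => if w == v then 0%N else (h w).+1) => [w w'|w].
  rewrite !inE => wQ w'Q.
  have [->|wv] := eqVneq w v; have [->|w'v] //= := eqVneq w' v.
  by case=> /hi; apply; rewrite !inE negb_or ?wv ?w'v.
move=> wQ; have [->|wv] := eqVneq w v.
  by move: Pv; congr (is_true (P _ _)); apply/setP => u; rewrite !inE andbF orbF.
have := hP w; rewrite !inE negb_or wv wQ => /(_ isT).
congr (is_true (P _ _)); apply/setP => u; rewrite !inE.
by case: (eqVneq u v) => [->|uv] /=; rewrite ?vQ ?orbT // ltnS.
Qed.

End Ordering.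

(** * Effective divisors and negative potentials *)

Section Dichotomy.
Variables (R : realType) (V : finType) (adj : rel V).
Implicit Types (c : V -> int) (z : V -> V -> R) (f g : V -> R) (v w : V).
Local Notation value := (potential_value adj).

(** Every edge carries a chip in its interior: no shifted moment is an
    integer. *)
Definition generic z f :=
  forall v w, v != w -> edge_floor z f v w + edge_floor z f w v = -1.

Lemma generic_perturbation z f (h : V -> nat) (d : R) : injective h ->
  (forall v w, edge_floor z (fun u => f u + d * (h u)%:R) v w =
      if (h v <= h w)%N then edge_floor z f v w
      else - edge_floor z f w v - 1) ->
  generic z (fun u => f u + d * (h u)%:R).
Proof.
move=> hi E v w vw; rewrite !E.
have : h v != h w by apply: contra_neq vw => /hi.
by case: ltngtP => // _ _; ring.
Qed.

(** Take the largest potential below the barrier [g] that is nonnegative away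
    from [q]; it can touch [g] at [q] only.  If its value at [q] is negative,
    run Dhar's burning algorithm from [q]: if the fire stopped at a proper set
    [Q], the complement of [Q] could be raised a little, contradicting
    maximality.  Raising the vertices slightly in burning order makes all
    values negative. *)
Lemma dichotomy_barrier c z q f0 g : antisym z ->
    (forall v, f0 v <= g v) ->
    (forall v, v != q -> 0 <= value c z f0 v) ->
    (forall v, v != q -> value c z g v <= -1) ->
  (exists f, forall v, 0 <= value c z f v) \/
  (exists f, (forall v, value c z f v <= -1) /\ generic z f).
Proof.
move=> zN f0g Lf0 Lg.
have [f [fg Lf fmax]] := maximal_potential f0g Lf0.
have [Lq|Lq] := leP 0 (value c z f q).
  by left; exists f => v; have [->|/Lf] := eqVneq v q.
right; have lt_fg v : v != q -> f v < g v.
  move=> vq; rewrite lt_neqAle fg andbT; apply/eqP => fgv.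
  suff: value c z f v <= value c z g v by have := Lf v vq; have := Lg v vq; lia.
  by apply: value_mono => w; have := fg w; rewrite fgv; lra.
(* The value at [v] after an infinitesimal rise of the complement of [Q]. *)
pose burn (Q : {set V}) v :=
  c v + \sum_(w | adj v w)
    (if w \in Q then - edge_floor z f w v - 1 else edge_floor z f v w).
have [Q QT|h hi hP] := @greedy_ordering V (fun Q v => burn Q v <= -1).
  have [qQ|qQ] := boolP (q \in Q); last first.
    exists q => //; have: burn Q q <= value c z f q; last by lia.
    rewrite lerD2l; apply: ler_sum => w _; case: ifP => // _.
    by have := edge_floor_swap f q w zN; lia.
  apply: contrapT => noburn.
  have burn0 v : v \notin Q -> 0 <= burn Q v.
    move=> vQ; rewrite leNgt; apply/negP => neg; apply: noburn.
    by exists v => //; lia.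
  pose pos v : nat := v \notin Q.
  have [e1 e10 He1] := perturbation f pos zN.
  have [v|e2 e20 He2] := @finite_smallness R V
    (fun v d => v \notin Q -> f v + d <= g v).
    have [->|vq] := eqVneq v q; first by exists 1; rewrite ?ltr01 ?qQ.
    exists (g v - f v); first by rewrite subr_gt0 lt_fg.
    by move=> d /andP[_ dle] _; lra.
  pose d := Num.min e1 e2.
  have d0 : 0 < d by rewrite lt_min e10.
  have d1 : 0 < d <= e1 by rewrite d0 ge_min lexx.
  have d2 : 0 < d <= e2 by rewrite d0 ge_min lexx orbT.
  have /set0Pn[v] : ~: Q != finset.set0.
    by apply: contra_neq QT => Q0; rewrite -[Q]finset.setCK Q0 finset.setC0.
  rewrite inE => vQ.
  suff: f v + d * (pos v)%:R <= f v by rewrite /pos vQ mulr1; lra.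
  apply: (fmax (fun u => f u + d * (pos u)%:R)) => [u|u uq].
    rewrite /pos; case: (boolP (u \in Q)) => uQ /=.
      by rewrite mulr0 addr0.
    by rewrite mulr1 He2.
  have [uQ|uQ] := boolP (u \in Q).
    apply: le_trans (Lf u uq) _; rewrite lerD2l; apply: ler_sum => w _.
    by rewrite He1 // /pos uQ.
  apply: le_trans (burn0 u uQ) _; rewrite lerD2l; apply: ler_sum => w _.
  by rewrite He1 // /pos uQ; case: (w \in Q).
have [e e0 He] := perturbation f h zN; have eP : 0 < e <= e by rewrite e0 /=.
exists (fun u => f u + e * (h u)%:R); split; last first.
  exact: generic_perturbation hi (He e eP).
move=> v; apply: le_trans (hP v); rewrite lerD2l; apply: ler_sum => w _.
by rewrite He // inE ltnNge; case: leqP.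
Qed.

End Dichotomy.

Section Bipartite.
Variables (R : realType) (m n : nat).
Local Notation V := ('I_m + 'I_n)%type.

Definition bipartite (v w : V) : bool :=
  match v, w with inl _, inr _ | inr _, inl _ => true | _, _ => false end.

Local Notation value := (potential_value bipartite).

Lemma big_bipartite_inl (F : V -> int) i :
  \sum_(w | bipartite (inl i) w) F w = \sum_j F (inr j).
Proof. by rewrite big_sumType /= big_pred0_eq add0r. Qed.

Lemma big_bipartite_inr (F : V -> int) j :
  \sum_(w | bipartite (inr j) w) F w = \sum_i F (inl i).
Proof. by rewrite big_sumType /= [X in _ + X]big_pred0_eq addr0. Qed.

Lemma edge_floor_int (z : V -> V -> R) (k : V -> int) v w :
  edge_floor z (fun u => (k u)%:~R) v w = Num.floor (z v w) + (k w - k v).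
Proof.
by rewrite /edge_floor -addrA -intrB floorDrz ?intr_int // intrKfloor.
Qed.

(** The barrier is a steep potential around a left vertex [q]: the height [K]
    exceeds every value at the zero potential, the right vertices lie at
    [m * K], and the other left vertices [K] above them.  The opposite potential has
    nonnegative values away from [q]. *)
Lemma dichotomy c (z : V -> V -> R) : (0 < m)%N -> (0 < n)%N -> antisym z ->
  (exists f, forall v, 0 <= value c z f v) \/
  (exists f, (forall v, value c z f v <= -1) /\ generic z f).
Proof.
move=> m0 n0 zN; pose q : V := inl (Ordinal m0).
pose L0 v : int := c v + \sum_(w | bipartite v w) Num.floor (z v w).
pose K : int := \sum_v `|L0 v| + 1.
have L0K v : - K < L0 v < K.
  have: `|L0 v| <= \sum_v `|L0 v|.
    by rewrite (bigD1 v) //= lerDl; apply: sumr_ge0.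
  rewrite /K; lia.
pose g (v : V) : int := match v with
  | inr _ => m%:Z * K | inl i => if i == Ordinal m0 then 0 else m%:Z * K + K end.
have valueE (k : V -> int) v : value c z (fun u => (k u)%:~R) v =
    L0 v + \sum_(w | bipartite v w) (k w - k v).
  rewrite /potential_value /L0 -addrA -big_split; congr (_ + _).
  by apply: eq_bigr => w _; rewrite edge_floor_int.
have lapl v : v != q -> \sum_(w | bipartite v w) (g w - g v) <= - K.
  have K0 : 0 < K by have := L0K q; lia.
  case: v => [i|j] vq.
    have iq : i != Ordinal m0 by apply: contra_neq vq => ->.
    rewrite big_bipartite_inl /= (negbTE iq) sumr_const card_ord.
    rewrite (_ : _ - _ = - K); last by ring.
    rewrite mulNrn lerN2; case: (n) n0 => // n' _; rewrite mulrS lerDl.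
    by apply: mulrn_wge0; apply: ltW.
  rewrite big_bipartite_inr (bigD1 (Ordinal m0)) // /g eqxx.
  rewrite (eq_bigr (fun=> K)).
    rewrite sumr_const cardC1 card_ord -mulr_natr natz.
    rewrite (_ : m.-1%:Z = m%:Z - 1); last by lia.
    by rewrite /= [leLHS](_ : _ = - K) //; ring.
  by move=> i iq; rewrite ifN //; ring.
apply: (@dichotomy_barrier _ _ _ c z q (fun u => (- g u)%:~R)
  (fun u => (g u)%:~R)) => //.
- move=> v; rewrite ler_int; suff: 0 <= g v by lia.
  have K0 : 0 < K by have := L0K q; lia.
  by case: v => [i|j] /=; [case: ifP => _|]; nia.
- move=> v vq; rewrite (valueE (fun u => - g u)).
  rewrite (eq_bigr (fun w => - (g w - g v))) => [|w _]; last by ring.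
  rewrite sumrN; move: (lapl v vq) (L0K v).
  by move: (\sum_(w | _) _) (L0 v) => s l; lia.
- move=> v vq; rewrite valueE; move: (lapl v vq) (L0K v).
  by move: (\sum_(w | _) _) (L0 v) => s l; lia.
Qed.

End Bipartite.

(** * Divisors of large rank *)

Lemma smallest_subset (R : realType) (T : finType) (u : T -> R) k :
  (k <= #|T|)%N ->
  exists2 I : {set T}, #|I| = k & forall i j, i \in I -> j \notin I -> u i <= u j.
Proof.
elim: k => [_|k IH lt_k].
  by exists finset.set0 => [|i j]; rewrite ?cards0 ?inE.
have [|I Ik Iu] := IH; first exact: ltnW.
have [i0 i0I] : exists i0, i0 \notin I.
  have /set0Pn[i0] : ~: I != finset.set0.
    by rewrite -card_gt0 cardsCs finset.setCK Ik subn_gt0.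
  by rewrite inE; exists i0.
have [i iI imin] := @Order.TotalTheory.arg_minP _ R T i0 (fun i => i \notin I) u i0I.
exists (i |: I); first by rewrite cardsU1 iI Ik.
move=> i1 j; rewrite !inE negb_or => /orP[/eqP->|i1I] /andP[_ jI]; first exact: imin.
exact: Iu.
Qed.

Section UpperBound.
Variables (R : realType) (m n : nat).
Local Notation V := ('I_m + 'I_n)%type.

(** [EA], [EB] and [k] are the degrees of an effective divisor [E] on the left
    vertices, on the right vertices and inside the edges, and [z] records its
    moments.  Weight the inequalities at [I], the [a + 1] lowest left vertices,
    and at [J], the right vertices below the top [t] of [I].  Floors from [I] to
    the complement of [J], and from [J] to the complement of [I], are
    nonnegative up to chips of [E], so
    [deg E >= (b + 1) |I| + (a + 1) |J| - |I| |J|]; with [|I| = a + 1] the terms in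
    [|J|] cancel. *)
Lemma grid_degree (a b : nat) (c : V -> int) (z : V -> V -> R) (f : V -> R)
    (EA : 'I_m -> int) (EB : 'I_n -> int) (k : 'I_m -> 'I_n -> int) :
  antisym z -> (a < m)%N ->
  (forall i, 0 <= EA i) -> (forall j, 0 <= EB j) ->
  (forall i j, 0 <= z (inl i) (inr j) <= (k i j)%:~R) ->
  (forall i, c (inl i) = b%:Z - EA i - \sum_j k i j) ->
  (forall j, c (inr j) = a%:Z - EB j) ->
  (forall v, potential_value (@bipartite m n) c z f v <= -1) ->
  a.+1%:Z * b.+1%:Z <= \sum_i EA i + \sum_j EB j + \sum_i \sum_j k i j.
Proof.
move=> zN am EA0 EB0 zk cA cB Lf.
have [|I Ia Imin] := @smallest_subset R _ (fun i : 'I_m => f (inl i)) a.+1.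
  by rewrite card_ord.
have [t tI It] : exists2 t, (forall i, i \in I -> f (inl i) <= t) &
    forall i, i \notin I -> t <= f (inl i).
  have [i0 i0I] : exists i0, i0 \in I by apply/set0Pn; rewrite -card_gt0 Ia.
  have [i iI imax] := @Order.TotalTheory.arg_maxP _ R 'I_m i0 (mem I) (f \o inl) i0I.
  by exists (f (inl i)) => j jI; [apply: imax|apply: Imin].
pose J := [set j | f (inr j) < t].
pose al i j := edge_floor z f (inl i) (inr j).
pose be i j := edge_floor z f (inr j) (inl i).
have albe i j : -1 <= al i j + be i j <= 0 by apply: edge_floor_swap.
have geA i : (if i \in I then b.+1%:Z else 0) +
    \sum_j (if i \in I then al i j - k i j else 0) <= EA i.
  case: ifP => _; last by rewrite big1 ?addr0.
  have := Lf (inl i); rewrite /potential_value big_bipartite_inl cA sumrB.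
  move: (\sum_j k i j); rewrite /al; move: (\sum_j _) => s s'; lia.
have geB j : (if j \in J then a.+1%:Z else 0) +
    \sum_i (if j \in J then be i j else 0) <= EB j.
  case: ifP => _; last by rewrite big1 ?addr0.
  have := Lf (inr j); rewrite /potential_value big_bipartite_inr cB.
  rewrite /be; move: (\sum_i _) => s; lia.
have pair i j : - (if i \in I then if j \in J then 1 else 0 else 0) <=
    (if i \in I then al i j - k i j else 0) + (if j \in J then be i j else 0) + k i j.
  have := albe i j; have := zk i j; rewrite /al /be.
  case: ifP => iI; case: ifP => jJ; move=> /andP[z0 zk1] ab.
  - by lia.
  - suff: 0 <= edge_floor z f (inl i) (inr j) by lia.
    by rewrite floor_ge0; have := tI i iI; move: jJ; rewrite inE; lra.
  - suff: - k i j <= edge_floor z f (inr j) (inl i) by lia.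
    rewrite floor_ge_int rmorphN /= (zN (inl i) (inr j)).
    by have := It i (negbT iI); move: jJ; rewrite inE; lra.
  - suff: (0 : int) <= k i j by lia.
    by rewrite -(ler0z R); lra.
have sumA : \sum_i (if i \in I then b.+1%:Z else 0) = a.+1%:Z * b.+1%:Z.
  by rewrite -big_mkcond sumr_const Ia -mulr_natl natz.
have sumB : \sum_j (if j \in J then a.+1%:Z else 0) = #|J|%:Z * a.+1%:Z.
  by rewrite -big_mkcond sumr_const -mulr_natl natz.
have sumIJ : \sum_i \sum_j - (if i \in I then if j \in J then 1 else 0 else 0 : int)
    = - (#|J|%:Z * a.+1%:Z).
  transitivity (- \sum_(i in I) \sum_(j in J) (1 : int)).
    rewrite -sumrN [RHS]big_mkcond; apply: eq_bigr => i _.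
    by case: ifP => _; rewrite sumrN -?big_mkcond // big1.
  by rewrite !sumr_const Ia; congr (- _); rewrite -mulr_natr !natz.
have HA : \sum_i ((if i \in I then b.+1%:Z else 0) +
    \sum_j (if i \in I then al i j - k i j else 0)) <= \sum_i EA i.
  by apply: ler_sum.
have HB : \sum_j ((if j \in J then a.+1%:Z else 0) +
    \sum_i (if j \in J then be i j else 0)) <= \sum_j EB j.
  by apply: ler_sum.
have HP : - (#|J|%:Z * a.+1%:Z) <= \sum_i \sum_j
    ((if i \in I then al i j - k i j else 0) + (if j \in J then be i j else 0) + k i j).
  by rewrite -sumIJ; apply: ler_sum => i _; apply: ler_sum => j _.
move: HP; under [leRHS]eq_bigr => i _ do rewrite !big_split /=; move=> HP.
move: HA HB HP; rewrite !big_split /= sumA sumB.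
rewrite [X in _ + X <= \sum_j EB j]exchange_big /=.
move: (\sum_i EA i) (\sum_j EB j) (\sum_i \sum_j k i j) => sA sB sk.
move: (\sum_i \sum_j _) (\sum_i \sum_j _) (_ * _) (_ * _) => x y u v; lia.
Qed.
End UpperBound.

(** * Ordering the vertices of a stable divisor *)

Section Staircases.
Variables (m n : nat) (Y c : 'I_n -> nat).
Hypotheses (Ym : forall j, (Y j < m)%N) (cm : forall j, (c j <= m)%N).
Hypothesis comonotone : forall j j', (Y j < Y j')%N -> (c j <= c j')%N.

(** In row [j] the excess cells are the columns from [c j] to [Y j], and the
    deficient cells those from [Y j + 1] to [c j - 1].  Since [c] and [Y] are sorted
    the same way, a column cannot contain both kinds of cell, nor can a row: with
    [P] the columns and [Q] the rows of excess cells, the excess lies in [P * Q] and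
    the deficiency in the product of the complements. *)
Lemma staircase_rectangles : exists p q : nat,
  [/\ (p <= m)%N, (q <= n)%N,
      (\sum_j ((Y j).+1 - c j) <= p * q)%N &
      (\sum_j (c j - (Y j).+1) <= (m - p) * (n - q))%N].
Proof.
pose P := [set x : 'I_m | [exists j, c j <= x <= Y j]%N].
pose Q := [set j : 'I_n | (c j <= Y j)%N].
have card_itv a b : (b <= m)%N -> #|[set x : 'I_m | a <= x < b]%N| = (b - a)%N.
  move=> bm; rewrite -[RHS]muln1 -sum_nat_const_nat (big_nat_widen _ _ m) //.
  rewrite (big_nat_widenl _ 0) // big_mkord -sum1_card; apply: eq_bigl => x.
  by rewrite inE andbC.
exists #|P|, #|Q|; split.
- by rewrite -[X in (_ <= X)%N]card_ord max_card.
- by rewrite -[X in (_ <= X)%N]card_ord max_card.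
- rewrite mulnC -sum_nat_const [leqRHS]big_mkcond; apply: leq_sum => j _.
  case: ifP => [jQ|]; last by rewrite inE; lia.
  rewrite -card_itv //; apply/subset_leq_card/fintype.subsetP => x; rewrite !inE => xj.
  by apply/existsP; exists j.
have -> : (m - #|P| = #|~: P|)%N by rewrite [RHS]cardsCs finset.setCK card_ord.
have -> : (n - #|Q| = #|~: Q|)%N by rewrite [RHS]cardsCs finset.setCK card_ord.
rewrite mulnC -sum_nat_const [leqRHS]big_mkcond; apply: leq_sum => j' _.
case: ifP => [_|]; last by rewrite !inE; lia.
rewrite -card_itv //; apply/subset_leq_card/fintype.subsetP => x; rewrite !inE => xj'.
apply/existsP => -[j xj]; have := @comonotone j' j; lia.
Qed.
End Staircases.

Section Order.
Variables (m n : nat) (x : 'I_m -> nat) (y : 'I_n -> nat) (S : 'I_m -> 'I_n -> bool).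
Local Notation V := ('I_m + 'I_n)%type.
Hypothesis xS : forall i, (x i + #|[set j | S i j]| < n)%N.

Definition before (pos : V -> nat) j := [set i | pos (inl i) < pos (inr j)]%N.

(** [x] and [y] count the chips at the vertices and [S] tells which edges carry
    an interior chip, which goes to the later end.  Right vertices are taken
    greedily, the one with the fewest chips first, counting the chips on edges to
    earlier left vertices.  A left vertex enters as soon as it sees more chip-free
    edges to earlier right vertices than it has chips; [xS] guarantees that this
    happens, and as these edges arrive one at a time it then sees exactly
    [x i + 1] of them.  Both sorts of count grow along the greedy order, which
    gives the last clause. *)
Lemma bipartite_order : exists pos : V -> nat,
  [/\ forall v w, bipartite v w -> pos v != pos w,
      forall i, #|[set j | (pos (inr j) < pos (inl i))%N && ~~ S i j]| = (x i).+1 &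
      forall j j', (y j + #|[set i in before pos j | S i j]| <
                    y j' + #|[set i in before pos j' | S i j']|)%N ->
        (#|before pos j| <= #|before pos j'|)%N].
Proof.
pose open i (Q : {set 'I_n}) := #|[set j in Q | ~~ S i j]|.
pose burnt Q := [set i | x i < open i Q]%N.
pose score Q j := (y j + #|[set i in burnt Q | S i j]|)%N.
have open_sub i (Q Q' : {set 'I_n}) : Q \subset Q' -> (open i Q <= open i Q')%N.
  move=> QQ'; apply/subset_leq_card/fintype.subsetP => j.
  by rewrite !inE => /andP[/(fintype.subsetP QQ')-> ->].
have burnt_sub (Q Q' : {set 'I_n}) : Q \subset Q' -> burnt Q \subset burnt Q'.
  move=> QQ'; apply/fintype.subsetP => i; rewrite !inE => /leq_trans; apply.
  exact: open_sub.
have score_sub (Q Q' : {set 'I_n}) j : Q \subset Q' -> (score Q j <= score Q' j)%N.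
  move=> QQ'; rewrite leq_add2l; apply/subset_leq_card/fintype.subsetP => i.
  by rewrite !inE => /andP[+ ->]; rewrite andbT => /leq_trans; apply; apply: open_sub.
have [Q QT|h hi hP] := @greedy_ordering _
    (fun Q j => [forall j', (j' \notin Q) ==> (score Q j <= score Q j')%N]).
  have /set0Pn[j0] : ~: Q != finset.set0.
    by apply: contra_neq QT => Q0; rewrite -[Q]finset.setCK Q0 finset.setC0.
  rewrite inE => j0Q; have [j jQ jmin] := @arg_minnP _ j0 (fun j => j \notin Q) (score Q) j0Q.
  by exists j => //; apply/forallP => j'; apply/implyP/jmin.
pose below t := [set j | h j < t]%N.
have below_sub t t' : (t <= t')%N -> below t \subset below t'.
  by move=> tt'; apply/fintype.subsetP => j; rewrite !inE => /leq_trans; apply.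
have [t tP tmin] : exists2 t : 'I_m -> nat, forall i, (x i < open i (below (t i)))%N &
    forall i s, (x i < open i (below s))%N -> (t i <= s)%N.
  have ex i : exists s, (x i < open i (below s))%N.
    exists (\max_j h j).+1.
    have -> : open i (below (\max_j h j).+1) = #|~: [set j | S i j]|.
      apply: eq_card => j; rewrite !inE ltnS.
      by rewrite (leq_bigmax_cond j) ?andbT.
    by have := xS i; have := cardsC [set j | S i j]; rewrite card_ord; lia.
  exists (fun i => ex_minn (ex i)) => [i|i s]; first by case: ex_minnP.
  by case: ex_minnP => s' _; apply.
have tx i : open i (below (t i)) = (x i).+1.
  have t0 : (0 < t i)%N.
    have := tP i; rewrite lt0n; apply: contraTneq => ->.
    rewrite [open _ _](_ : _ = 0%N) //; apply/eqP; rewrite cards_eq0.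
    by apply/eqP/setP => j; rewrite !inE ltn0.
  have le1 : (open i (below (t i).-1) <= x i)%N.
    by rewrite leqNgt; apply/negP => /tmin; rewrite leqNgt prednK ?leqnn.
  suff: (open i (below (t i)) <= open i (below (t i).-1) + 1)%N by have := tP i; lia.
  have one : (#|[set j | h j == (t i).-1]| <= 1)%N.
    by apply/card_le1_eqP => j j'; rewrite !inE => /eqP<- /eqP/hi.
  apply: leq_trans (leq_add (leqnn _) one); rewrite /open.
  apply: leq_trans (leq_card_setU _ _); apply/subset_leq_card/fintype.subsetP => j.
  by rewrite !inE => /andP[ht ->]; rewrite andbT; lia.
(* Even positions for left and odd ones for right vertices: the left vertex [i]
   comes after exactly the right vertices with [h j < t i]. *)
pose pos (v : V) := match v with inl i => (2 * t i)%N | inr j => (2 * h j + 1)%N end.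
have beforeE j : before pos j = burnt (below (h j)).
  apply/setP => i; rewrite !inE /=; apply/idP/idP.
    move=> lt; apply: leq_trans (tP i) _; apply/open_sub/below_sub; lia.
  by move/tmin; lia.
exists pos; split=> [v w|i|j j'].
- by case: v w => [i|j] [i'|j'] //= _; apply/eqP; lia.
- rewrite -tx; apply: eq_card => j; rewrite !inE /=; congr (_ && _); lia.
rewrite !beforeE -/(score _ j) -/(score _ j') => lt.
apply/subset_leq_card/burnt_sub/below_sub; rewrite leqNgt; apply/negP => hh.
have /forallP/(_ j)/implyP := hP j'; rewrite inE -leqNgt ltnW // => /(_ isT).
rewrite -/(below (h j')) => le.
have := score_sub _ _ j (below_sub _ _ (ltnW hh)); lia.
Qed.

End Order.

(** * Degrees of divisors of large rank *)

Section RankBound.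
Variables (R : realType) (V : finType) (adj : rel V).
Implicit Types (c : V -> int) (z : V -> V -> R) (f g : V -> R) (v w : V).
Local Notation value := (potential_value adj).

(** Removing the summands, topped up to degree [r] at [v0], leaves a divisor for
    which [f] has only negative values. *)
Lemma rank_certificate c z (r : nat) f v0 :
  (forall E : V -> nat, (\sum_v E v)%N = r ->
     exists f, forall v, 0 <= value (fun v => c v - (E v)%:Z) z f v) ->
  r.+1%:Z <= \sum_v Num.max 0 (value c z f v + 1).
Proof.
move=> H; rewrite leNgt; apply/negP => lt.
pose E0 v : nat := absz (Num.max 0 (value c z f v + 1)).
have E0E v : (E0 v)%:Z = Num.max 0 (value c z f v + 1) by rewrite /E0; lia.
have sE0 : (\sum_v E0 v)%N%:Z = \sum_v Num.max 0 (value c z f v + 1).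
  by rewrite -natz natr_sum; apply: eq_bigr => v _; rewrite natz.
pose E v := (E0 v + (v == v0) * (r - \sum_u E0 u))%N.
have sE : (\sum_v E v)%N = r.
  rewrite big_split /= [X in (_ + X)%N](bigD1 v0) //= eqxx mul1n.
  rewrite [X in (_ + (_ + X))%N]big1 => [|v /negPf->]; last by rewrite mul0n.
  by move: lt; rewrite -sE0 ltz_nat ltnS addn0 => /subnKC.
have [g gE] := H E sE.
have [||v Lv] := @certificate_sound _ _ adj (fun v => c v - (E v)%:Z) z f g.
- by apply/card_gt0P; exists v0.
- move=> v; have := E0E v; rewrite /potential_value /E; move: (\sum_(w | _) _) => s; lia.
by have := gE v; rewrite leNgt (le_lt_trans Lv).
Qed.

Lemma edge_floor_shift z f (a : R) v w :
  edge_floor z (fun u => f u + a) v w = edge_floor z f v w.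
Proof. by rewrite /edge_floor; congr Num.floor; ring. Qed.

(** [c v - \sum_w edge_floor z f w v] counts the chips at [v] together with those
    inside its edges; [v] can be raised when this number reaches its valence.  The
    hypothesis on [g0] holds if the canonical divisor minus the given one is
    effective in the potential [- g0].  In the largest effective potential below a
    translate of [g0], a vertex strictly below this bound cannot be raised by
    maximality, and a vertex touching the bound has at most as many chips as in
    [g0]. *)
Lemma no_vertex_fires c z f0 g0 : antisym z -> irreflexive adj ->
  (forall v, 0 <= value c z f0 v) ->
  (forall v, c v - \sum_(w | adj v w) edge_floor z g0 w v
             <= (\sum_(w | adj v w) 1) - 1) ->
  exists f, forall v, 0 <= value c z f v /\
    c v - \sum_(w | adj v w) edge_floor z f w v <= (\sum_(w | adj v w) 1) - 1.
Proof.
move=> zN adjI Lf0 Ug0; pose M : R := \sum_v `|f0 v - g0 v|.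
pose g v := g0 v + M.
have f0g v : f0 v <= g v.
  have: f0 v - g0 v <= M; last by rewrite /g; lra.
  apply: le_trans (ler_norm _) _.
  by rewrite /M (bigD1 v) //= lerDl; apply: sumr_ge0.
have [|f [fg Lf fmax]] := @maximal_potential _ _ adj c z xpredT _ _ f0g; first by [].
exists f => v; split; first exact: Lf.
have [fgv|fgv] := eqVneq (f v) (g v).
  apply: le_trans (Ug0 v); rewrite lerD2l lerN2; apply: ler_sum => w _.
  rewrite -(edge_floor_shift _ _ M); apply: edge_floor_lower.
  by have := fg w; rewrite -/(g v) -/(g w) fgv; lra.
rewrite leNgt; apply/negP => fires.
pose pos u : nat := u == v.
have [e e0 He] := perturbation f pos zN.
have lt : f v < g v by rewrite lt_neqAle fgv fg.
pose d := Num.min e (g v - f v).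
have d0 : 0 < d by rewrite lt_min e0 subr_gt0.
have d1 : 0 < d <= e by rewrite d0 ge_min lexx.
have dg : d <= g v - f v by rewrite ge_min lexx orbT.
suff: f v + d * (pos v)%:R <= f v by rewrite /pos eqxx mulr1; lra.
apply: (fmax (fun u => f u + d * (pos u)%:R)) => [u|u _].
  rewrite /pos; case: eqVneq => [->|_]; rewrite ?mulr0 ?addr0 ?fg //.
  by rewrite mulr1; lra.
rewrite /potential_value; have [->|uv] := eqVneq u v.
  rewrite (eq_bigr (fun w => - edge_floor z f w v - 1)) => [|w vw]; last first.
    rewrite He // /pos eqxx; case: eqVneq => // wv.
    by rewrite wv adjI in vw.
  by rewrite sumrB sumrN; move: fires; move: (\sum_(w | _) _) (\sum_(w | _) _); lia.
apply: le_trans (Lf u isT) _; rewrite lerD2l; apply: ler_sum => w _.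
by rewrite He // /pos (negbTE uv).
Qed.

End RankBound.

Section LowerBound.
Variables (R : realType) (m n : nat).
Local Notation V := ('I_m + 'I_n)%type.
Local Notation value := (potential_value (@bipartite m n)).
Implicit Types (c : V -> int) (z : V -> V -> R) (f : V -> R).

Lemma sum_inl_inr (F : V -> int) :
  \sum_v F v = \sum_i F (inl i) + \sum_j F (inr j).
Proof. by rewrite big_sumType. Qed.

(** Each of the [m * n] edges retains one chip. *)
Lemma sum_value_generic c z f :
  (forall v w, bipartite v w -> edge_floor z f v w + edge_floor z f w v = -1) ->
  \sum_v value c z f v = \sum_v c v - (m * n)%:Z.
Proof.
move=> gen; rewrite big_split /=; congr (_ + _); rewrite sum_inl_inr.
rewrite (eq_bigr _ (fun i _ => big_bipartite_inl _ i)).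
rewrite [X in _ + X](eq_bigr _ (fun j _ => big_bipartite_inr _ j)).
rewrite [X in _ + X]exchange_big -big_split /=.
rewrite (eq_bigr (fun=> - n%:Z)) => [|i _]; last first.
  rewrite -big_split (eq_bigr (fun=> -1)) => [|j _]; last by rewrite /= gen.
  by rewrite sumr_const card_ord mulNrn natz.
by rewrite sumr_const card_ord -mulr_natr natz PoszM; ring.
Qed.

Lemma sum_value_succ c z f :
  (forall v w, bipartite v w -> edge_floor z f v w + edge_floor z f w v = -1) ->
  \sum_v (value c z f v + 1) = \sum_v c v - (m * n)%:Z + m%:Z + n%:Z.
Proof.
move=> /(sum_value_generic c) E; rewrite big_split /= E sumr_const card_sum !card_ord natz.
by rewrite PoszD addrA.
Qed.

Lemma card_setZ (T : finType) (P : pred T) :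
  #|[set t | P t]|%:Z = \sum_t (P t)%:Z.
Proof.
rewrite -sum1dep_card big_mkcond -[LHS]natz natr_sum.
by apply: eq_bigr => t _; case: ifP.
Qed.

Lemma valence_inl i : \sum_(w | @bipartite m n (inl i) w) 1 = n%:Z.
Proof. by rewrite big_bipartite_inl sumr_const card_ord natz. Qed.

Lemma valence_inr j : \sum_(w | @bipartite m n (inr j) w) 1 = m%:Z.
Proof. by rewrite big_bipartite_inr sumr_const card_ord natz. Qed.

Lemma bipartite_irreflexive : irreflexive (@bipartite m n).
Proof. by case. Qed.

(** The dichotomy for the canonical divisor minus the given one decides between
    [p = m], [q = n] and the rectangle cut out by the staircases of a stable
    potential. *)
Theorem degree_lower_bound c z (r : nat) :
  (0 < m)%N -> (0 < n)%N -> (r < m * n)%N -> antisym z ->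
  (forall E : V -> nat, (\sum_v E v)%N = r ->
     exists f, forall v, 0 <= value (fun v => c v - (E v)%:Z) z f v) ->
  exists p q : nat, [/\ (0 < p <= m)%N, (0 < q <= n)%N, (r < p * q)%N &
    (p%:Z - 1) * n%:Z + (q%:Z - 1) * m%:Z - (p%:Z * q%:Z - 1 - r%:Z) <= \sum_v c v].
Proof.
move=> m0 n0 rmn zN H; pose v0 : V := inl (Ordinal m0).
have rL f := rank_certificate f v0 H.
(* [cK] and [zK] describe the canonical divisor minus the given one. *)
pose zK v w := - z v w; have zKN : antisym zK by move=> v w; rewrite /zK zN.
pose cK v := \sum_(w | @bipartite m n v w) 1 - 2 - c v.
have valueK f v : value cK zK (fun u => - f u) v =
    \sum_(w | @bipartite m n v w) 1 - 2
    - (c v - \sum_(w | bipartite v w) edge_floor z f w v).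
  rewrite /potential_value opprB addrA addrAC; congr (_ + _).
  apply: eq_bigr => w _; rewrite (edge_floor_rev _ _ _ zN) /edge_floor /zK.
  by congr Num.floor; ring.
(* Case of a nonspecial divisor first: genericity turns an upper bound on the
   values of [K - D] into the lower bound [-1] on those of [D]. *)
have [[f Kf]|[f [Kf gen]]] := dichotomy cK m0 n0 zKN; last first.
  pose g v := - f v; have fE : f = (fun u => - g u).
    by apply/funext => u; rewrite /g opprK.
  have gen' : generic z g.
    move=> v w vw; rewrite -(gen w v) 1?eq_sym // fE.
    by rewrite /edge_floor /zK (zN v w); congr (_ + _); congr Num.floor; ring.
  have Lg v : -1 <= value c z g v.
    have E : \sum_(w | bipartite v w) edge_floor z g w v =
        - \sum_(w | bipartite v w) edge_floor z g v w - \sum_(w | bipartite v w) 1.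
      rewrite -sumrN -sumrB; apply: eq_bigr => w vw.
      suff: v != w by move/gen'; lia.
      by apply: contraTneq vw => ->; rewrite bipartite_irreflexive.
    have := Kf v; rewrite fE valueK E /potential_value.
    by move: (\sum_(w | _) _) (\sum_(w | _) _); lia.
  exists m, n; split; rewrite ?m0 ?n0 ?leqnn //.
  have := rL g; rewrite (eq_bigr (fun v => value c z g v + 1)) => [|v _].
    rewrite sum_value_succ; first by lia.
    by move=> v w vw; apply: gen'; apply: contraTneq vw => ->; rewrite bipartite_irreflexive.
  by have := Lg v; lia.
have [f0 Lf0] : exists f, forall v, 0 <= value c z f v.
  have [|f0 Lf0] := H (fun v => (v == v0) * r)%N.
    rewrite (bigD1 v0) // eqxx mul1n big1 /= ?addn0 // => v /negPf->.
    by rewrite mul0n.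
  exists f0 => v; apply: le_trans (Lf0 v) _; rewrite /potential_value; lia.
(* Special case: both [D] and [K - D] are effective. *)
have [|f1 f1P] := no_vertex_fires zN bipartite_irreflexive Lf0 (g0 := fun v => - f v).
  move=> v; have := valueK (fun u => - f u) v.
  rewrite (_ : (fun u => - - f u) = f); last by apply/funext => u; rewrite opprK.
  have := Kf v => /[swap] ->; rewrite subr_ge0 => /le_trans; apply.
  by rewrite lerD2l.
pose fl := edge_floor z f1.
pose S i j := fl (inl i) (inr j) + fl (inr j) (inl i) == -1.
have SE i j : (S i j)%:Z = - fl (inl i) (inr j) - fl (inr j) (inl i).
  have := edge_floor_swap f1 (inl i) (inr j) zN; rewrite /S -/(fl _ _) -/(fl _ _).
  by case: eqVneq; lia.
pose x i := absz (value c z f1 (inl i)); pose y j := absz (value c z f1 (inr j)).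
have xE i : (x i)%:Z = value c z f1 (inl i) by have [] := f1P (inl i); rewrite /x; lia.
have yE j : (y j)%:Z = value c z f1 (inr j) by have [] := f1P (inr j); rewrite /y; lia.
have xS i : (x i + #|[set j | S i j]| < n)%N.
  have [_] := f1P (inl i); rewrite valence_inl -ltz_nat PoszD xE card_setZ.
  rewrite /potential_value !big_bipartite_inl (eq_bigr _ (fun j _ => SE i j)).
  rewrite sumrB sumrN /fl.
  by move: (\sum_j _) (\sum_j _) => s s'; lia.
have yS j : (y j + #|[set i | S i j]| < m)%N.
  have [_] := f1P (inr j); rewrite valence_inr -ltz_nat PoszD yE card_setZ.
  rewrite /potential_value !big_bipartite_inr (eq_bigr _ (fun i _ => SE i j)).
  rewrite sumrB sumrN /fl.
  by move: (\sum_i _) (\sum_i _) => s s'; lia.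
have [pos [pos_ne pos_A pos_B]] := @bipartite_order m n x y S xS.
have [e e0 He] := perturbation f1 pos zN.
have {He} := He e; rewrite e0 lexx => /(_ isT).
set f2 := (fun u => _) => He.
have gen2 v w : bipartite v w -> edge_floor z f2 v w + edge_floor z f2 w v = -1.
  by move=> /pos_ne; rewrite !He; case: ltngtP => // _ _; ring.
(* Breaking ties costs a vertex one chip for each earlier neighbour whose edge is
   chip-free. *)
have L2A i : value c z f2 (inl i) = -1.
  have : value c z f2 (inl i) = (x i)%:Z
      - \sum_j ((pos (inr j) < pos (inl i))%N && ~~ S i j)%:Z.
    rewrite xE /potential_value !big_bipartite_inl -addrA -sumrB; congr (_ + _).
    apply: eq_bigr => j _; rewrite He leqNgt; have := SE i j; rewrite /fl.
    by case: ltnP => _ /=; case: (S i j); lia.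
  by move->; rewrite -card_setZ pos_A; lia.
pose Y j := (y j + #|[set i in before pos j | S i j]|)%N.
pose k j := #|before pos j|.
have L2B j : value c z f2 (inr j) = (Y j)%:Z - (k j)%:Z.
  rewrite /Y /k /before PoszD yE !card_setZ /potential_value !big_bipartite_inr.
  rewrite -!addrA -sumrB -big_split; congr (_ + _); apply: eq_bigr => i _ /=.
  rewrite He leqNgt inE; have := SE i j; rewrite /fl.
  by case: ltnP => _ /=; case: (S i j); lia.
have Ym j : (Y j < m)%N.
  apply: leq_ltn_trans (yS j); rewrite leq_add2l; apply/subset_leq_card.
  by apply/fintype.subsetP => i; rewrite !inE => /andP[].
have km j : (k j <= m)%N by rewrite -[X in (_ <= X)%N]card_ord max_card.
have [p [q [pm qn N M]]] := @staircase_rectangles m n Y k Ym km pos_B.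
have := rL f2; have := sum_value_succ c gen2.
rewrite !sum_inl_inr big1 ?add0r => [|i _]; last by rewrite L2A.
rewrite [X in _ <= X + _]big1 ?add0r => [|i _]; last by rewrite L2A.
have -> : \sum_j (value c z f2 (inr j) + 1) =
    (\sum_j ((Y j).+1 - k j))%N%:Z - (\sum_j (k j - (Y j).+1))%N%:Z.
  rewrite -[X in _ = X - _]natz -[X in _ = _ - X]natz !natr_sum -sumrB.
  by apply: eq_bigr => j _; rewrite L2B; lia.
have -> : \sum_j Num.max 0 (value c z f2 (inr j) + 1) =
    (\sum_j ((Y j).+1 - k j))%N%:Z.
  rewrite -[RHS]natz natr_sum; apply: eq_bigr => j _; rewrite L2B; lia.
move: N M; move: (\sum_j ((Y j).+1 - k j))%N (\sum_j (k j - (Y j).+1))%N.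
move=> N M NE ME sc rN.
have r_pq : (r < p * q)%N by lia.
exists p, q; split=> //.
- by rewrite pm andbT lt0n; apply: contraTneq r_pq => ->.
- by rewrite qn andbT lt0n; apply: contraTneq r_pq => ->; rewrite muln0.
have ME' : M%:Z <= (m%:Z - p%:Z) * (n%:Z - q%:Z).
  by rewrite !subzn // -PoszM lez_nat.
move: sc ME' rN; rewrite PoszM; lia.
Qed.

End LowerBound.

(** * Additive functionals of divisors *)

Lemma eq_big_support (S : nmodType) (T : eqType) (r1 r2 : seq T) (F : T -> S) :
  uniq r1 -> uniq r2 ->
  (forall x, F x != 0 -> x \in r1) -> (forall x, F x != 0 -> x \in r2) ->
  \sum_(x <- r1) F x = \sum_(x <- r2) F x.
Proof.
move=> u1 u2 s1 s2.
have drop0 r : \sum_(x <- r) F x = \sum_(x <- [seq x <- r | F x != 0]) F x.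
  rewrite big_filter [LHS](bigID (fun x => F x != 0)) /=.
  by rewrite [X in _ + X]big1 ?addr0 // => x /negPn/eqP.
rewrite drop0 [RHS]drop0; apply: perm_big; apply: uniq_perm; rewrite ?filter_uniq //.
move=> x; rewrite !mem_filter; case: (boolP (F x != 0)) => //= Fx.
by rewrite s1 // s2.
Qed.

Section Weight.
Variables (T : choiceType) (S : pzRingType).
Implicit Types (D : {freeg T / int}) (w : T -> S).

Definition weight w D : S := \sum_(p <- dom D) (coeff p D)%:~R * w p.

Lemma weight_support w D (r : seq T) : uniq r ->
  (forall p, coeff p D != 0 -> w p != 0 -> p \in r) ->
  weight w D = \sum_(p <- r) (coeff p D)%:~R * w p.
Proof.
move=> ur Dr; apply: eq_big_support => // [|p|p]; first exact: uniq_dom.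
  by rewrite mem_dom; apply: contra_neq => ->; rewrite mul0r.
by move=> nz; apply: Dr; apply: contra_neq nz => ->; rewrite ?mul0r ?mulr0.
Qed.

Lemma weightD w D1 D2 : weight w (D1 + D2) = weight w D1 + weight w D2.
Proof.
pose r := undup (dom D1 ++ dom D2); have ur : uniq r by apply: undup_uniq.
have sub p : coeff p D1 != 0 \/ coeff p D2 != 0 -> p \in r.
  by rewrite mem_undup mem_cat !mem_dom => -[->|->] //; rewrite orbT.
rewrite !(@weight_support w _ r) // => [|p H _|p H _|p H _].
- by rewrite -big_split; apply: eq_bigr => p _; rewrite coeffD intrD mulrDl.
- by apply: sub; right.
- by apply: sub; left.
apply: sub; have [D10|] := eqVneq (coeff p D1) 0; last by left.
by right; rewrite coeffD D10 add0r in H.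
Qed.

Lemma weightN w D : weight w (- D) = - weight w D.
Proof.
rewrite (@weight_support w _ (dom D)) ?uniq_dom // => [|p]; last first.
  by rewrite coeffN oppr_eq0 mem_dom.
by rewrite -sumrN; apply: eq_bigr => p _; rewrite coeffN intrN mulNr.
Qed.

Lemma weightB w D1 D2 : weight w (D1 - D2) = weight w D1 - weight w D2.
Proof. by rewrite weightD weightN. Qed.

Lemma weightU w k p : weight w << k *g p >> = k%:~R * w p.
Proof.
rewrite (@weight_support w _ [:: p]) // => [|q].
  by rewrite big_seq1 coeffU eqxx mulr1.
have [->|qp] := eqVneq q p; first by rewrite inE eqxx.
by rewrite coeffU [p == q]eq_sym (negbTE qp) mulr0 eqxx.
Qed.

Lemma weight0 w : weight w 0 = 0.
Proof. by rewrite /weight dom0 big_nil. Qed.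

Lemma weight_sum w (I : Type) (r : seq I) (P : pred I) (F : I -> {freeg T / int}) :
  weight w (\sum_(i <- r | P i) F i) = \sum_(i <- r | P i) weight w (F i).
Proof.
by elim/big_rec2: _ => [|i y x _ <-]; rewrite ?weight0 ?weightD.
Qed.

Lemma eq_weight w w' D : w =1 w' -> weight w D = weight w' D.
Proof. by move=> E; apply: eq_bigr => p _; rewrite E. Qed.

Lemma weight_add w w' D :
  weight (fun p => w p + w' p) D = weight w D + weight w' D.
Proof. by rewrite -big_split; apply: eq_bigr => p _; rewrite mulrDr. Qed.

Lemma weight_bigsum (I : finType) (w : I -> T -> S) D :
  weight (fun p => \sum_i w i p) D = \sum_i weight (w i) D.
Proof. by rewrite exchange_big; apply: eq_bigr => p _; rewrite mulr_sumr. Qed.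

End Weight.

Lemma weight_eq (T : choiceType) (D : {freeg T / int}) p :
  weight (fun q => (q == p)%:R : int) D = coeff p D.
Proof.
rewrite (@weight_support _ _ _ _ [:: p]) // => [|q _].
  by rewrite big_seq1 eqxx mulr1 intz.
by rewrite inE; case: (q == p).
Qed.

Lemma deg_weight (T : choiceType) (D : {freeg T / int}) :
  deg D = weight (fun=> 1 : int) D.
Proof.
rewrite -[in LHS](freeg_sumE D) raddf_sum; apply: eq_bigr => p _.
by rewrite /= degU mulr1 intz.
Qed.

(** * Points, edge degrees and moments *)

Section Points.
Variables (R : realType) (G : mgraph R).
Implicit Types (D Q : divisor G) (p : point G) (e : edge G) (v : vert G).
Implicit Types (f : vert G -> R) (phi : point G -> R) (t x : R).

Definition on_edge e p : bool := if val p is inr (e', _) then e' == e else false.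
Definition param p : R := if val p is inr (_, t) then t else 0.

Lemma val_epoint e t : 0 < t < len e -> val (epoint e t) = inr (e, t).
Proof.
move=> /andP[t0 tl]; rewrite /epoint leNgt t0 leNgt tl /= insubdK //.
by rewrite -topredE /= t0 tl.
Qed.

Lemma epoint0 e : epoint e 0 = vpoint (src e).
Proof. by rewrite /epoint lexx. Qed.

Lemma epoint_len e : epoint e (len e) = vpoint (tgt e).
Proof. by rewrite /epoint leNgt len_gt0 lexx. Qed.

Lemma on_edge_epoint e' e t : 0 < t < len e -> on_edge e' (epoint e t) = (e == e').
Proof. by move=> tl; rewrite /on_edge val_epoint. Qed.

Lemma param_epoint e t : 0 < t < len e -> param (epoint e t) = t.
Proof. by move=> tl; rewrite /param val_epoint. Qed.

Lemma on_edgeP e p : on_edge e p -> 0 < param p < len e /\ p = epoint e (param p).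
Proof.
rewrite /on_edge /param; case: p => -[//|[e' t]] tl /= /eqP e'e.
subst e'; split; first exact: tl.
by apply: val_inj; rewrite (val_epoint tl).
Qed.

Lemma eq_vpoint v v' : (vpoint v == vpoint v') = (v == v').
Proof. by rewrite -val_eqE. Qed.

Lemma eq_epoint_vpoint e t v : 0 < t < len e -> (epoint e t == vpoint v) = false.
Proof. by move=> tl; rewrite -val_eqE val_epoint. Qed.

Lemma point_ind (P : point G -> Prop) : (forall v, P (vpoint v)) ->
  (forall e t, 0 < t < len e -> P (epoint e t)) -> forall p, P p.
Proof.
move=> Pv Pe p; case E: (val p) => [v|[e t]].
  by have -> : p = vpoint v by apply: val_inj.
have tl : 0 < t < len e by have := valP p; rewrite E.
have -> : p = epoint e t by apply: val_inj; rewrite val_epoint.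
exact: Pe.
Qed.

Definition edge_degree D e : int := weight (fun p => (on_edge e p)%:R) D.
Definition moment D e : R := weight (fun p => if on_edge e p then param p else 0) D.
Definition vertex_degree D v : int :=
  coeff (vpoint v) D + \sum_(e | src e == v) edge_degree D e.

Lemma deg_vertex_degree D : deg D = \sum_v vertex_degree D v.
Proof.
rewrite deg_weight big_split /= (exchange_big_dep predT) //=.
transitivity (\sum_v coeff (vpoint v) D + \sum_e edge_degree D e); last first.
  by congr (_ + _); apply: eq_bigr => e _; rewrite (big_pred1 (src e)).
rewrite (eq_bigr _ (fun v _ => esym (weight_eq D (vpoint v)))).
rewrite -!weight_bigsum -weight_add; apply: eq_weight.
apply: point_ind => [v|e t tl].
  rewrite (bigD1 v) //= eqxx !big1 ?addr0 // => v' v'v.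
  by rewrite eq_vpoint eq_sym (negbTE v'v).
rewrite big1 ?add0r => [|v _]; last by rewrite eq_epoint_vpoint.
rewrite (bigD1 e) //= on_edge_epoint // eqxx big1 ?addr0 // => e' e'e.
by rewrite on_edge_epoint // eq_sym (negbTE e'e).
Qed.

End Points.

(** * Divisors of rational functions *)

Section Principal.
Variables (R : realType) (G : mgraph R).
Implicit Types (D Q : divisor G) (p : point G) (e : edge G) (v : vert G).
Implicit Types (f : vert G -> R) (phi : point G -> R) (t x : R).

Lemma slopeE phi e t (u : R) (s : int) :
  (exists eps : R, 0 < eps /\ forall h, 0 <= h < eps ->
     phi (epoint e (t + u * h)) = phi (epoint e t) + s%:~R * h) ->
  slope phi e t u = s.
Proof.
move=> [d [d0 Hd]]; rewrite /slope; case: xgetP => [s' _ [d' [d'0 Hd']]|/(_ s) []].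
  pose h := Num.min d d' / 2.
  have h0 : 0 < h by rewrite divr_gt0 // lt_min d0.
  have [hd hd'] : h < d /\ h < d'.
    have : Num.min d d' <= d by rewrite ge_min lexx.
    have : Num.min d d' <= d' by rewrite ge_min lexx orbT.
    have : 0 < Num.min d d' by rewrite lt_min d0.
    by rewrite /h; lra.
  have := Hd h; rewrite (ltW h0) hd => /(_ isT).
  rewrite Hd' ?(ltW h0) // => /addrI /mulIf.
  by rewrite gt_eqF // => /(_ isT) /intr_inj.
by exists d.
Qed.

Section Breakpoints.
Variables (phi : point G -> R) (e : edge G) (k : nat) (t : nat -> R) (s : nat -> int).
Hypotheses (t0 : t 0%N = 0) (tk : t k = len e)
  (t_incr : forall i, (i < k)%N -> t i < t i.+1)
  (affine : forall i x, (i < k)%N -> t i <= x <= t i.+1 ->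
    phi (epoint e x) = phi (epoint e (t i)) + (s i)%:~R * (x - t i)).

Lemma pieces_gt0 : (0 < k)%N.
Proof.
by rewrite lt0n; apply/eqP => k0; move: tk; rewrite k0 t0 => /eqP; rewrite lt_eqF ?len_gt0.
Qed.

Lemma breakpoint_ltn i j : (i < j)%N -> (j <= k)%N -> t i < t j.
Proof.
elim: j => // j IH; rewrite ltnS leq_eqVlt => /predU1P[->|ij] jk; first exact: t_incr.
by apply: lt_trans (t_incr jk); apply: IH => //; apply: ltnW.
Qed.

Lemma breakpoint_interior i : (i < k.-1)%N -> 0 < t i.+1 < len e.
Proof.
move=> ik; rewrite -t0 -tk; apply/andP; split; apply: breakpoint_ltn => //; lia.
Qed.

Lemma piece_of x : 0 <= x < len e -> exists2 i, (i < k)%N & t i <= x < t i.+1.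
Proof.
rewrite -t0 -tk => /andP[x0 xk]; have := pieces_gt0.
suff find j : (j <= k)%N -> x < t j -> exists2 i, (i < k)%N & t i <= x < t i.+1.
  by move=> _; apply: find xk.
elim: j => [_|j IH jk xj]; first by rewrite ltNge x0.
by have [xtj|xtj] := leP (t j) x; [exists j; rewrite // xtj|apply: IH => //; apply: ltnW].
Qed.

Lemma slope_right i x : (i < k)%N -> t i <= x < t i.+1 -> slope phi e x 1 = s i.
Proof.
move=> ik /andP[xi xS]; apply: slopeE; exists (t i.+1 - x).
rewrite subr_gt0 xS; split=> // h hP; rewrite mul1r (affine ik) ?(affine ik (x := x)).
- by ring.
- by rewrite xi ltW.
- lra.
Qed.

Lemma slope_left i x : (i < k)%N -> t i < x <= t i.+1 -> slope phi e x (-1) = - s i.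
Proof.
move=> ik /andP[xi xS]; apply: slopeE; exists (x - t i).
rewrite subr_gt0 xi; split=> // h hP; rewrite mulN1r (affine ik) ?(affine ik (x := x)).
- by rewrite rmorphN /=; ring.
- by rewrite xS ltW.
- lra.
Qed.

Lemma slope_src : slope phi e 0 1 = s 0.
Proof.
apply: slope_right; first exact: pieces_gt0.
by rewrite t0 lexx -t0 t_incr // pieces_gt0.
Qed.

Lemma slope_tgt : slope phi e (len e) (-1) = - s k.-1.
Proof.
have k0 := pieces_gt0; apply: slope_left; first by rewrite prednK.
by rewrite prednK // tk lexx -tk -[X in _ < t X]prednK // t_incr // prednK.
Qed.

Lemma slope_sum_epoint x : 0 < x < len e ->
  slope_sum phi (epoint e x) = slope phi e x 1 + slope phi e x (-1).
Proof. by move=> xl; rewrite /slope_sum val_epoint. Qed.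

Lemma slope_sum_breakpoint i : (i < k.-1)%N ->
  slope_sum phi (epoint e (t i.+1)) = s i.+1 - s i.
Proof.
move=> ik; rewrite slope_sum_epoint ?breakpoint_interior //.
rewrite (@slope_right i.+1) ?(@slope_left i) //; try lia.
  by rewrite lexx t_incr //; lia.
by rewrite lexx t_incr //; lia.
Qed.

Lemma slope_sum_neq0 x : 0 < x < len e -> slope_sum phi (epoint e x) != 0 ->
  exists2 i, (i < k.-1)%N & x = t i.+1.
Proof.
move=> xl; have /andP[x0 xe] := xl; have [|i ik /andP[ti tS]] := @piece_of x.
  by rewrite ltW.
rewrite slope_sum_epoint // (@slope_right i) ?ti //.
have [xt|xt] := eqVneq x (t i).
  case: i ik xt {ti tS} => [|i] ik xt _; last by exists i => //; lia.
  by move: x0; rewrite xt t0 ltxx.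
by rewrite (@slope_left i) ?subrr ?eqxx // lt_neqAle eq_sym xt ti ltW.
Qed.

(** The interior of [e] meets the divisor of [phi] in the breakpoints only, where
    the coefficient is the change of slope. *)
Lemma sum_breakpoints (S : pzRingType) Q (psi : R -> S) :
  (forall p, coeff p Q = slope_sum phi p) ->
  weight (fun p => if on_edge e p then psi (param p) else 0) Q =
    \sum_(i < k.-1) (s i.+1 - s i)%:~R * psi (t i.+1).
Proof.
move=> Qphi.
rewrite (@weight_support _ _ _ _ [seq epoint e (t i.+1) | i <- iota 0 k.-1]).
- rewrite big_map (_ : iota 0 k.-1 = index_iota 0 k.-1).
    rewrite big_mkord; apply: eq_bigr => i _; have ti := breakpoint_interior (ltn_ord i).
    by rewrite Qphi slope_sum_breakpoint // on_edge_epoint // eqxx param_epoint.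
  by rewrite /index_iota subn0.
- rewrite map_inj_in_uniq ?iota_uniq // => i j.
  rewrite !mem_iota !add0n /= => ik jk /(congr1 (@param _ _)).
  rewrite !param_epoint ?breakpoint_interior // => tij.
  case: (ltngtP i j) => // ij.
    by have := @breakpoint_ltn i.+1 j.+1; rewrite tij ltxx; lia.
  by have := @breakpoint_ltn j.+1 i.+1; rewrite tij ltxx; lia.
move=> p cp; case: ifP => [ep _|]; last by rewrite eqxx.
have [pl pE] := on_edgeP ep; have [|i ik pt] := slope_sum_neq0 pl.
  by rewrite -pE -Qphi.
rewrite pE pt.
by apply/mapP; exists i => //; rewrite mem_iota.
Qed.

Lemma edge_degree_principal Q : (forall p, coeff p Q = slope_sum phi p) ->
  edge_degree Q e = - slope phi e 0 1 - slope phi e (len e) (-1).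
Proof.
move=> Qphi; rewrite slope_src slope_tgt opprK addrC.
rewrite -(telescope_sumr s (leq0n k.-1)) big_mkord.
transitivity (weight (fun p => if on_edge e p then (fun=> 1) (param p) else 0 : int) Q).
  by apply: eq_weight => p; case: ifP.
by rewrite (sum_breakpoints (fun=> 1) Qphi); apply: eq_bigr => i _; rewrite mulr1 intz.
Qed.

(** Summation by parts: the moment is minus the increase of [phi] along [e], up to
    the boundary term of the slope at the target. *)
Lemma moment_principal Q : (forall p, coeff p Q = slope_sum phi p) ->
  moment Q e = phi (vpoint (src e)) - phi (vpoint (tgt e))
               - (slope phi e (len e) (-1))%:~R * len e.
Proof.
move=> Qphi; rewrite slope_tgt -epoint0 -epoint_len.
transitivity (\sum_(i < k.-1) (s i.+1 - s i)%:~R * t i.+1).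
  exact: (sum_breakpoints id Qphi).
have abel j : (j < k)%N -> phi (epoint e (t j.+1)) - phi (epoint e 0) =
    (s j)%:~R * t j.+1 - \sum_(i < j) (s i.+1 - s i)%:~R * t i.+1.
  elim: j => [|j IH] jk; rewrite (affine jk) ?lexx ?ltW ?t_incr //.
    by rewrite big_ord0 t0; ring.
  rewrite big_ord_recr /= opprD addrA; have := IH (ltnW jk); rewrite intrB.
  by move: (\sum_(i < j) _) => sm E; lra.
have k0 := pieces_gt0; have := abel k.-1; rewrite prednK // tk => /(_ (leqnn _)).
by rewrite rmorphN /= => E; lra.
Qed.

End Breakpoints.
End Principal.

Lemma weight_intr (T : choiceType) (S : pzRingType) (w : T -> int) (D : {freeg T / int}) :
  (weight w D)%:~R = weight (fun p => (w p)%:~R : S) D.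
Proof.
by rewrite rmorph_sum; apply: eq_bigr => p _; rewrite rmorphM /= intz.
Qed.

Section Realization.
Variables (R : realType) (G : mgraph R).
Implicit Types (D Q : divisor G) (p : point G) (e : edge G) (v : vert G).
Implicit Types (f a : vert G -> R) (phi : point G -> R) (t x : R).

(** [a] gives the values at the vertices and [sigma] the slopes at the targets of
    the edges.  Conversely these conditions characterize principal divisors, see
    [principal_of_data]. *)
Lemma principal_data Q : principal Q -> exists a (sigma : edge G -> int),
  (forall e, moment Q e = a (src e) - a (tgt e) - (sigma e)%:~R * len e) /\
  (forall v, vertex_degree Q v =
     \sum_(e | tgt e == v) sigma e - \sum_(e | src e == v) sigma e).
Proof.
move=> [phi [rphi Qphi]]; exists (phi \o @vpoint _ _).
exists (fun e => slope phi e (len e) (-1)); split=> [e|v].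
  have [k [t [s [t0 tk t_incr affine]]]] := rphi e.
  exact: moment_principal t0 tk t_incr affine _ Qphi.
rewrite /vertex_degree Qphi /slope_sum /=.
rewrite [X in _ + X = _](eq_bigr (fun e => - slope phi e 0 1 - slope phi e (len e) (-1))).
  by rewrite sumrB sumrN; ring.
move=> e _; have [k [t [s [t0 tk t_incr affine]]]] := rphi e.
exact: edge_degree_principal t0 tk t_incr affine _ Qphi.
Qed.

(** The function on [e] that vanishes near its source and bends as prescribed by
    [Q]; its slope at [t] is the mass of [Q] before [t]. *)
Definition bend Q e t : R :=
  weight (fun p => if on_edge e p then Num.max 0 (t - param p) else 0) Q.

Definition mass Q e (P : pred R) : int :=
  weight (fun p => (on_edge e p && P (param p))%:R) Q.

Lemma bend_affine Q e t x : t <= x ->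
  (forall p, p \in dom Q -> on_edge e p -> param p <= t \/ x <= param p) ->
  bend Q e x = bend Q e t + (mass Q e (fun y => y <= t))%:~R * (x - t).
Proof.
move=> tx gap; rewrite weight_intr mulr_suml -big_split /bend /weight.
rewrite !big_seq; apply: eq_bigr => p pQ /=.
rewrite -mulrA -mulrDr; congr (_ * _).
have := gap p pQ; case: ifP => [_ /(_ isT) gp|_ _] /=; last by rewrite mul0r addr0.
have [pt|pt] := leP (param p) t.
  by rewrite mul1r !max_r ?subr_ge0 // ?(le_trans pt) //; ring.
rewrite mul0r addr0 !max_l // subr_le0; first exact: ltW.
by case: gp => // /le_lt_trans/(_ pt); rewrite ltxx.
Qed.

Lemma eq_mass Q e (P P' : pred R) :
  (forall p, p \in dom Q -> on_edge e p -> P (param p) = P' (param p)) ->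
  mass Q e P = mass Q e P'.
Proof.
move=> E; rewrite /mass /weight !big_seq; apply: eq_bigr => p pQ.
by congr (_ * _%:R); case: (boolP (on_edge e p)) => //= /(E p pQ) ->.
Qed.

Lemma parameter_gap Q e t : exists2 eps : R, 0 < eps &
  forall p d, p \in dom Q -> 0 < d <= eps ->
    [\/ param p <= t - d, param p = t | t + d <= param p].
Proof.
apply: (@seq_smallness R (point G) (dom Q) (fun p d =>
  [\/ param p <= t - d, param p = t | t + d <= param p])) => p _.
have [pt|pt|->] := ltgtP (param p) t.
- exists (t - param p); rewrite ?subr_gt0 // => d /andP[d0 dle].
  by apply: Or31; lra.
- exists (param p - t); rewrite ?subr_gt0 // => d /andP[d0 dle].
  by apply: Or33; lra.
- by exists 1 => // d _; apply: Or32.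
Qed.

(** The function with given values at the vertices, given slopes at the targets and
    the bends of [Q]: the condition on the moment makes its values at the two ends
    of an edge match, the condition on the degree is the one at the vertices. *)
Section Construction.
Variables (Q : divisor G) (a : vert G -> R) (sigma : edge G -> int).
Hypothesis momentQ : forall e,
  moment Q e = a (src e) - a (tgt e) - (sigma e)%:~R * len e.
Hypothesis degreeQ : forall v, vertex_degree Q v =
  \sum_(e | tgt e == v) sigma e - \sum_(e | src e == v) sigma e.

Definition initial_slope e : int := - edge_degree Q e - sigma e.

Definition on_closed_edge e t : R :=
  a (src e) + (initial_slope e)%:~R * t + bend Q e t.

Definition primitive p : R :=
  match val p with inl v => a v | inr (e, t) => on_closed_edge e t end.

Lemma bend0 e : bend Q e 0 = 0.
Proof.
apply: big1 => p _; case: ifP => [/on_edgeP[/andP[p0 _] _]|_]; last by rewrite mulr0.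
by rewrite max_l ?mulr0 // sub0r oppr_le0 ltW.
Qed.

Lemma bend_len e : bend Q e (len e) = (edge_degree Q e)%:~R * len e - moment Q e.
Proof.
rewrite weight_intr mulr_suml -sumrB; apply: eq_bigr => p _.
rewrite -mulrA -mulrBr; congr (_ * _).
case: ifP => [/on_edgeP[/andP[_ pl] _]|_]; last by rewrite mul0r subr0.
by rewrite mul1r max_r // subr_ge0 ltW.
Qed.

Lemma primitive_epoint e t : 0 <= t <= len e -> primitive (epoint e t) = on_closed_edge e t.
Proof.
move=> /andP[]; rewrite le_eqVlt => /predU1P[<- _|t0].
  by rewrite epoint0 /primitive /= /on_closed_edge bend0; ring.
rewrite le_eqVlt => /predU1P[->|tl].
  rewrite epoint_len /primitive /= /on_closed_edge bend_len momentQ /initial_slope.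
  by rewrite intrB rmorphN /=; ring.
by rewrite /primitive val_epoint ?t0.
Qed.

Lemma primitive_slope_right e t : 0 <= t < len e ->
  slope primitive e t 1 = initial_slope e + mass Q e (fun y => y <= t).
Proof.
move=> /andP[t0 tl]; have [eps eps0 gap] := parameter_gap Q e t.
apply: slopeE; exists (Num.min eps (len e - t)).
rewrite lt_min eps0 subr_gt0 tl; split=> // h; rewrite lt_min mul1r => /and3P[h0 he hl].
have t1 : 0 <= t <= len e by rewrite t0 ltW.
have th1 : 0 <= t + h <= len e by apply/andP; split; lra.
rewrite !primitive_epoint //.
rewrite /on_closed_edge (@bend_affine Q e t) ?lerDl // => [|p pQ _].
  by rewrite intrD; ring.
move: h0; rewrite le_eqVlt => /predU1P[<-|h0].
  by rewrite addr0; case: (leP (param p) t) => [|/ltW]; [left|right].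
have hP : 0 < h <= eps by rewrite h0 ltW.
by case: (gap p h pQ hP) => [pt|->|pt]; [left; lra|left|right].
Qed.

Lemma primitive_slope_left e t : 0 < t <= len e ->
  slope primitive e t (-1) = - (initial_slope e + mass Q e (fun y => y < t)).
Proof.
move=> /andP[t0 tl]; have [eps eps0 gap] := parameter_gap Q e t.
apply: slopeE; exists (Num.min eps t).
rewrite lt_min eps0; split=> // h; rewrite lt_min mulN1r => /and3P[h0 he hl].
have t1 : 0 <= t <= len e by rewrite ltW.
have th1 : 0 <= t - h <= len e by apply/andP; split; lra.
rewrite !primitive_epoint //.
move: h0; rewrite le_eqVlt => /predU1P[<-|h0]; first by rewrite subr0 mulr0 addr0.
have dichotomy p : p \in dom Q -> param p <= t - h \/ t <= param p.
  have hP : 0 < h <= eps by rewrite h0 ltW.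
  by move=> pQ; case: (gap p h pQ hP) => [pt|->|pt]; [left|right|right; lra].
rewrite /on_closed_edge (@bend_affine Q e (t - h) t) => [||p pQ _]; last exact: dichotomy.
  rewrite (@eq_mass Q e (fun y => y <= t - h) (fun y => y < t)) => [|p pQ _].
    by rewrite rmorphN /initial_slope !intrD /=; ring.
  by apply/idP/idP; have [] := dichotomy p pQ; lra.
by lra.
Qed.

(** The subdivision consists of the ends and of all points of [Q] on the edge. *)
Lemma primitive_rational : rational_fun primitive.
Proof.
move=> e; pose r0 := [:: 0, len e & [seq param p | p <- dom Q & on_edge e p]].
pose r := sort <=%R (undup r0).
have r_sorted : sorted <%R r.
  by rewrite sort_lt_sorted undup_uniq.
have mem_r x : (x \in r) = (x \in r0) by rewrite mem_sort mem_undup.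
have r_bounds x : x \in r -> 0 <= x <= len e.
  have e0 := ltW (len_gt0 e).
  rewrite mem_r !inE => /or3P[/eqP->|/eqP->|/mapP[p pr ->]]; rewrite ?lexx ?e0 //.
  by move: pr; rewrite mem_filter => /andP[/on_edgeP[/andP[p0 pl] _] _]; rewrite !ltW.
have r_0 : 0 \in r by rewrite mem_r inE eqxx.
have r_len : len e \in r by rewrite mem_r !inE eqxx orbT.
have [k sk] : exists k, size r = k.+1.
  by exists (size r).-1; rewrite prednK //; case: (r) r_0.
have nth_mono i j : (i <= k)%N -> (j <= k)%N ->
    (nth (len e) r i < nth (len e) r j) = (i < j)%N.
  by move=> ik jk; rewrite (lt_sorted_ltn_nth _ r_sorted) // inE sk ltnS.
have nth_bounds i : (i <= k)%N -> 0 <= nth (len e) r i <= len e.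
  by move=> ik; apply: r_bounds; rewrite mem_nth // sk ltnS.
exists k, (nth (len e) r).
exists (fun i => initial_slope e + mass Q e (fun y => y <= nth (len e) r i)).
split.
- have /(nthP (len e))[i] := r_0; rewrite sk ltnS => ik i0.
  have := nth_mono 0%N i isT ik; rewrite i0 ltNge (andP (nth_bounds _ _)).1 //=.
  by case: i ik i0.
- have /(nthP (len e))[i] := r_len; rewrite sk ltnS => ik il.
  have := nth_mono i k ik (leqnn k).
  rewrite il ltNge (andP (nth_bounds _ _)).2 //= => /esym/negbT.
  by rewrite -leqNgt => ki; rewrite (@anti_leq k i) ?ki.
- by move=> i ik; rewrite nth_mono // ltnW.
move=> i x ik /andP[ix xi].
have [i1 i2] : (i <= k)%N /\ (i.+1 <= k)%N by rewrite ltnW.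
have b1 := nth_bounds _ i1; have b2 := nth_bounds _ i2.
rewrite !primitive_epoint //; last first.
  by apply/andP; split; [have /andP[? _] := b1|have /andP[_ ?] := b2]; lra.
rewrite /on_closed_edge (@bend_affine Q e (nth (len e) r i)) // => [|p pQ pe].
  by rewrite intrD; ring.
have : param p \in r.
  by rewrite mem_r !inE map_f ?orbT // mem_filter pe.
move=> /(nthP (len e))[j]; rewrite sk ltnS => jr <-; have [ji|ij] := leqP j i.
  left; move: ji; rewrite leq_eqVlt => /predU1P[->//|ji].
  by rewrite ltW // nth_mono.
right; apply: le_trans xi _; move: ij; rewrite leq_eqVlt => /predU1P[->//|ij].
by rewrite ltW // nth_mono.
Qed.

Lemma mass_true e (P : pred R) : (forall t, 0 < t < len e -> P t) ->
  mass Q e P = edge_degree Q e.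
Proof.
move=> PT; apply: eq_weight => p; case: (boolP (on_edge e p)) => //= /on_edgeP[pl _].
by rewrite PT.
Qed.

Lemma mass_false e (P : pred R) : (forall t, 0 < t < len e -> ~~ P t) ->
  mass Q e P = 0.
Proof.
move=> PF; apply: big1 => p _; case: (boolP (on_edge e p)) => [/on_edgeP[pl _]|_].
  by rewrite (negbTE (PF _ pl)) mulr0.
by rewrite mulr0.
Qed.

Lemma slope_sum_primitive p : slope_sum primitive p = coeff p Q.
Proof.
move: p; apply: point_ind => [v|e t /[dup] tl /andP[t0 te]].
  have := degreeQ v; rewrite /vertex_degree /slope_sum /= => dQ.
  rewrite [X in X + _](eq_bigr (fun e => - edge_degree Q e - sigma e)) => [|e _]; last first.
    rewrite primitive_slope_right ?lexx ?len_gt0 // mass_false ?addr0 //.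
    by move=> t /andP[t0 _]; rewrite -ltNge.
  rewrite [X in _ + X = coeff _ _](eq_bigr sigma) => [|e _]; last first.
    rewrite primitive_slope_left ?lexx ?len_gt0 // mass_true => [|t /andP[]//].
    by rewrite /initial_slope; ring.
  rewrite sumrB sumrN; move: dQ => /(canRL (addrK _)) ->; ring.
rewrite /slope_sum val_epoint // primitive_slope_right ?ltW //.
rewrite primitive_slope_left ?t0 ?ltW // opprD addrACA subrr add0r -sumrB -weight_eq.
apply: eq_bigr => p _; rewrite -mulrBr; congr (_ * _).
case: (boolP (on_edge e p)) => [/on_edgeP[pl ->]|pe] /=.
  rewrite -val_eqE !val_epoint //=.
  rewrite param_epoint // -[inr _ == inr _]/((e, param p) == (e, t)) xpair_eqE eqxx /=.
  by case: ltgtP.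
case: eqVneq => // pE.
by rewrite pE on_edge_epoint // eqxx in pe.
Qed.

Lemma principal_of_data : principal Q.
Proof.
exists primitive; split; first exact: primitive_rational.
by move=> p; rewrite slope_sum_primitive.
Qed.

End Construction.
End Realization.

(** * Effectiveness in terms of potentials *)

Section Criterion.
Variables (R : realType) (G : mgraph R).
Implicit Types (D E Q : divisor G) (p : point G) (e : edge G) (v : vert G).
Implicit Types (f a : vert G -> R) (t x : R).

Lemma moment_bounds E e : effective E ->
  0 <= moment E e <= (edge_degree E e)%:~R * len e.
Proof.
move=> E0; apply/andP; split.
  apply: sumr_ge0 => p _; apply: mulr_ge0; first by rewrite ler0z.
  by case: ifP => // /on_edgeP[/andP[/ltW]].
rewrite weight_intr mulr_suml; apply: ler_sum => p _.
rewrite -mulrA; apply: ler_wpM2l; first by rewrite ler0z.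
case: ifP => [/on_edgeP[/andP[_ /ltW pl] _]|_]; last by rewrite mul0r.
by rewrite mul1r.
Qed.

Definition chip_value D f v : int := vertex_degree D v
  + \sum_(e | src e == v) Num.floor ((f (tgt e) - f (src e) - moment D e) / len e)
  + \sum_(e | tgt e == v) Num.floor ((moment D e + f (src e) - f (tgt e)) / len e).

Lemma vertex_degreeB D1 D2 v :
  vertex_degree (D1 - D2) v = vertex_degree D1 v - vertex_degree D2 v.
Proof.
rewrite /vertex_degree coeffB (eq_bigr _ (fun e _ => weightB _ D1 D2)) sumrB.
by rewrite /edge_degree; ring.
Qed.

Lemma momentB D1 D2 e : moment (D1 - D2) e = moment D1 e - moment D2 e.
Proof. exact: weightB. Qed.

(** Use the potential [- a] where [a] are the values of the function from [D] to the
    effective divisor [D'].  The moment of [D'] on an edge lies between 0 and the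
    length times its degree, so rounding sends no vertex below its coefficient in
    [D']. *)
Lemma chip_value_of_effective D : equiv_effective D ->
  exists f, forall v, 0 <= chip_value D f v.
Proof.
move=> [D' [D'0 /principal_data[a [sigma [mQ dQ]]]]].
exists (fun v => - a v) => v.
have vD : vertex_degree D v = vertex_degree D' v +
    \sum_(e | tgt e == v) sigma e - \sum_(e | src e == v) sigma e.
  by have := dQ v; rewrite vertex_degreeB => E; rewrite -addrA -E; ring.
have mD e : moment D e = moment D' e + (a (src e) - a (tgt e) - (sigma e)%:~R * len e).
  by have := mQ e; rewrite momentB => E; rewrite -E; ring.
have floor_src e : - edge_degree D' e + sigma e <=
    Num.floor ((- a (tgt e) - - a (src e) - moment D e) / len e).
  rewrite floor_ge_int ler_pdivlMr ?len_gt0 // intrD rmorphN /= mD.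
  by have /andP[_] := moment_bounds e D'0; lra.
have floor_tgt e : - sigma e <=
    Num.floor ((moment D e + - a (src e) - - a (tgt e)) / len e).
  rewrite floor_ge_int ler_pdivlMr ?len_gt0 // rmorphN /= mD.
  by have /andP[+ _] := moment_bounds e D'0; lra.
have sum_src : \sum_(e | src e == v) (- edge_degree D' e + sigma e) <=
    \sum_(e | src e == v) Num.floor ((- a (tgt e) - - a (src e) - moment D e) / len e).
  by apply: ler_sum.
have sum_tgt : \sum_(e | tgt e == v) (- sigma e) <=
    \sum_(e | tgt e == v) Num.floor ((moment D e + - a (src e) - - a (tgt e)) / len e).
  by apply: ler_sum.
apply: le_trans (lerD (lerD (lexx _) sum_src) sum_tgt).
rewrite vD /vertex_degree big_split /= !sumrN.
rewrite [leRHS](_ : _ = coeff (vpoint v) D'); last by ring.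
exact: D'0.
Qed.

Definition vertex_divisor (c : vert G -> int) : divisor G :=
  \sum_v << c v *g vpoint v >>.

Lemma coeff_vertex_divisor_vpoint c v : coeff (vpoint v) (vertex_divisor c) = c v.
Proof.
rewrite raddf_sum (bigD1 v) //= coeffU eqxx mulr1 big1 ?addr0 // => u uv.
by rewrite coeffU eq_vpoint (negbTE uv) mulr0.
Qed.

Lemma coeff_vertex_divisor_epoint c e t : 0 < t < len e ->
  coeff (epoint e t) (vertex_divisor c) = 0.
Proof.
move=> tl; rewrite raddf_sum big1 //= => v _.
by rewrite coeffU eq_sym eq_epoint_vpoint // mulr0.
Qed.

Lemma vertex_divisor_effective c : (forall v, 0 <= c v) -> effective (vertex_divisor c).
Proof.
move=> c0; apply: point_ind => [v|e t tl].
  by rewrite coeff_vertex_divisor_vpoint.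
by rewrite coeff_vertex_divisor_epoint.
Qed.

Lemma edge_degree_vertex_divisor c e : edge_degree (vertex_divisor c) e = 0.
Proof. by rewrite /edge_degree weight_sum big1 // => v _; rewrite weightU mulr0. Qed.

Lemma moment_vertex_divisor c e : moment (vertex_divisor c) e = 0.
Proof. by rewrite /moment weight_sum big1 // => v _; rewrite weightU mulr0. Qed.

Lemma vertex_degree_vertex_divisor c v : vertex_degree (vertex_divisor c) v = c v.
Proof.
rewrite /vertex_degree coeff_vertex_divisor_vpoint big1 ?addr0 // => e _.
exact: edge_degree_vertex_divisor.
Qed.

(** On [e] the shifted moment [M e] is realized by sending [l e] chips from the source
    to the target and leaving one chip at the remainder [rho e] if this is
    positive. *)
Lemma effective_of_chip_value D f : (forall v, 0 <= chip_value D f v) ->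
  equiv_effective D.
Proof.
move=> f0; pose M e := moment D e + f (src e) - f (tgt e).
pose l e := Num.floor (M e / len e).
pose rho e := M e - (l e)%:~R * len e.
have rho_bounds e : 0 <= rho e < len e.
  have := floor_itv (M e / len e); rewrite -/(l e) ler_pdivlMr ?len_gt0 //.
  rewrite ltr_pdivrMr ?len_gt0 // intrD mulrDl mul1r /rho.
  by move=> /andP[? ?]; apply/andP; split; lra.
have floorN_M e : Num.floor (- M e / len e) = - l e - (0 < rho e)%R%:Z.
  apply: floor_def; rewrite !ler_pdivlMr ?ltr_pdivrMr ?len_gt0 //.
  have := rho_bounds e; rewrite /rho => /andP[r0 r1].
  case: ltP => r2; rewrite !(intrD, intrB, rmorphN) /=; apply/andP; split; lra.
pose chips : divisor G := \sum_(e | 0 < rho e) << epoint e (rho e) >>.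
have rho_in e : 0 < rho e -> 0 < rho e < len e.
  by move=> ->; have /andP[] := rho_bounds e.
pose D' := vertex_divisor (chip_value D f) + chips.
have chips_vpoint v : coeff (vpoint v) chips = 0.
  rewrite raddf_sum big1 //= => e r0.
  by rewrite coeffU eq_epoint_vpoint ?rho_in // mulr0.
have chips_degree e : edge_degree chips e = (0 < rho e)%R%:Z.
  rewrite /edge_degree weight_sum.
  rewrite (eq_bigr (fun e' => (e' == e)%:Z)) => [|e' r0].
    have [re|re] := boolP (0 < rho e).
      rewrite (bigD1 e) //= eqxx big1 ?addr0 // => e' /andP[_ /negPf->] //.
    rewrite big1 // => e' r0; case: eqVneq => // e'e.
    by rewrite -e'e r0 in re.
  by rewrite weightU mul1r on_edge_epoint ?rho_in // natz.
have chips_moment e : moment chips e = rho e.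
  rewrite /moment weight_sum.
  rewrite (eq_bigr (fun e' => if e' == e then rho e else 0)) => [|e' r0].
    have [re|re] := boolP (0 < rho e).
      rewrite (bigD1 e) //= eqxx big1 ?addr0 // => e' /andP[_ /negPf->] //.
    rewrite big1 => [|e' r0].
      by have := rho_bounds e; move: re; rewrite -leNgt; lra.
    by case: eqVneq => // e'e; rewrite -e'e r0 in re.
  rewrite weightU mul1r on_edge_epoint ?rho_in //.
  by case: eqVneq => [<-|//]; rewrite param_epoint ?rho_in.
exists D'; split.
  move=> p; rewrite coeffD addr_ge0 ?vertex_divisor_effective //.
  rewrite raddf_sum sumr_ge0 // => e _.
  by rewrite /= coeffU mul1r ler0n.
apply: (@principal_of_data _ _ _ (fun v => - f v) (fun e => - l e)) => [e|v].
  rewrite momentB {1}/D' /moment weightD -!/(moment _ _) moment_vertex_divisor.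
  by rewrite chips_moment rmorphN /rho /M /=; ring.
rewrite vertex_degreeB.
have -> : vertex_degree D' v = chip_value D f v + \sum_(e | src e == v) (0 < rho e)%R%:Z.
  rewrite /vertex_degree coeffD coeff_vertex_divisor_vpoint chips_vpoint addr0.
  congr (_ + _); apply: eq_bigr => e _.
  by rewrite /edge_degree weightD -!/(edge_degree _ _) edge_degree_vertex_divisor add0r.
rewrite /chip_value.
rewrite [X in _ - (_ + X + _ + _)](eq_bigr (fun e => - l e - (0 < rho e)%R%:Z)).
  rewrite sumrB !sumrN /l /M; ring.
by move=> e _; rewrite -floorN_M; congr (Num.floor (_ / _)); rewrite /M; ring.
Qed.

Theorem equiv_effectiveP D :
  equiv_effective D <-> exists f, forall v, 0 <= chip_value D f v.
Proof.
by split=> [/chip_value_of_effective|[f /effective_of_chip_value]].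
Qed.

End Criterion.

(** * The genus *)

Section Genus.
Variables (R : realType) (m n : nat) (m0 : (0 < m)%N) (n0 : (0 < n)%N).
Local Notation G := (Kmn R m n).

Lemma mulmx_boundary_tr (u : 'rV[rat]_#|vert G|) e :
  (u *m (boundary G)^T) 0 (enum_rank e) =
    u 0 (enum_rank (tgt e)) - u 0 (enum_rank (src e)).
Proof.
rewrite mxE (eq_bigr (fun k => (k == enum_rank (tgt e))%:R * u 0 k
   - (k == enum_rank (src e))%:R * u 0 k)) => [|k _]; last first.
  rewrite !mxE enum_rankK mulrBr ![u 0 k * _]mulrC.
  by rewrite ![k == _]eq_sym !(can2_eq enum_rankK enum_valK).
rewrite sumrB; congr (_ - _).
  by rewrite (bigD1 (enum_rank (tgt e))) //= eqxx mul1r big1 ?addr0 // => k /negPf->;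
     rewrite mul0r.
by rewrite (bigD1 (enum_rank (src e))) //= eqxx mul1r big1 ?addr0 // => k /negPf->;
   rewrite mul0r.
Qed.

(** The graph is connected, so the coboundary of a function on the vertices
    vanishes only for constants and the boundary has rank [m + n - 1]. *)
Lemma genus_Kmn : (genus G)%:Z = (m%:Z - 1) * (n%:Z - 1).
Proof.
have card_vert : #|vert G| = (m + n)%N by rewrite card_sum !card_ord.
have card_edge : #|edge G| = (m * n)%N by rewrite card_prod !card_ord.
pose ones : 'rV[rat]_#|vert G| := const_mx 1.
pose v0 : vert G := inl (Ordinal m0); pose w0 : vert G := inr (Ordinal n0).
have ker1 : (kermx (boundary G)^T :=: ones)%MS.
  apply/eqmxP/andP; split.
    apply/rV_subP => u /sub_kermxP u0.
    have edge_eq i j : u 0 (enum_rank (inr j : vert G)) = u 0 (enum_rank (inl i : vert G)).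
      apply/eqP; rewrite -subr_eq0; have := mulmx_boundary_tr u (i, j).
      by rewrite u0 mxE => <-.
    have -> : u = u 0 (enum_rank v0) *: ones.
      apply/rowP => k; rewrite !mxE mulr1 -[k]enum_valK.
      case: (enum_val k) => [i|j]; last exact: edge_eq.
      by rewrite -(edge_eq i (Ordinal n0)) -(edge_eq (Ordinal m0) (Ordinal n0)).
    exact: scalemx_sub.
  apply/sub_kermxP/rowP => k; rewrite -[k]enum_valK mulmx_boundary_tr !mxE.
  exact: subrr.
have := mxrank_ker (boundary G)^T; rewrite ker1 rank_rV mxrank_tr.
have -> : ones != 0.
  by apply/eqP => /rowP/(_ (enum_rank v0)); rewrite !mxE => /eqP; rewrite oner_eq0.
have := rank_leq_col (boundary G); have := rank_leq_row (boundary G).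
rewrite /genus mxrank_ker; move: (\rank _) => k.
rewrite card_vert card_edge => km kn k1; have -> : k = (m + n - 1)%N by lia.
rewrite -subzn ?PoszM; last by lia.
rewrite -subzn ?PoszD; last by lia.
ring.
Qed.

End Genus.

(** * Rank and gonality *)

Lemma xget_unique (T : choiceType) (x0 x : T) (P : set T) : P x ->
  (forall y, P y -> y = x) -> xget x0 P = x.
Proof. by move=> Px uniq_x; case: xgetP => [y _ /uniq_x|/(_ x)]. Qed.

Lemma bounded_int_max (A : set int) x b : A x -> (forall y, A y -> y <= b) ->
  exists y, A y /\ forall z, A z -> z <= y.
Proof.
move=> Ax ub; pose P k := `[< A (b - k%:Z) >].
have exP : exists k, P k.
  exists (absz (b - x)); apply/asboolP.
  by rewrite (_ : b - _ = x) //; have := ub x Ax; lia.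
case: (ex_minnP exP) => k /asboolP Ak kmin; exists (b - k%:Z); split=> // z Az.
have zb := ub z Az; have bz : b - (absz (b - z))%:Z = z by lia.
by have := kmin (absz (b - z)); rewrite /P bz => /(_ (asboolT Az)); lia.
Qed.

Lemma zmax_attained (A : set int) x b : A x -> (forall y, A y -> y <= b) ->
  A (zmax A) /\ forall y, A y -> y <= zmax A.
Proof.
move=> Ax ub; have [y [Ay ymax]] := bounded_int_max Ax ub.
suff -> : zmax A = y by [].
apply: xget_unique => // z [Az zmax]; apply/eqP; rewrite eq_le ymax //.
exact: zmax.
Qed.

Lemma zmin_eq (A : set int) x : A x -> (forall y, A y -> x <= y) -> zmin A = x.
Proof.
move=> Ax xmin; apply: xget_unique => // y [Ay ymin].
by apply/eqP; rewrite eq_le ymin ?xmin.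
Qed.

Lemma zmin_attained (A : set int) x b : A x -> (forall y, A y -> b <= y) ->
  A (zmin A) /\ forall y, A y -> zmin A <= y.
Proof.
move=> Ax lb.
have [||y [Ay ymax]] := @bounded_int_max (fun y => A (- y)) (- x) (- b).
- by rewrite opprK.
- by move=> y /lb; lia.
have ymin z : A z -> - y <= z.
  by move=> Az; have := ymax (- z); rewrite opprK => /(_ Az); lia.
by rewrite (zmin_eq Ay).
Qed.

Section Rank.
Variables (R : realType) (G : mgraph R).
Implicit Types (D E : divisor G) (f : vert G -> R).

Lemma sum_chip_value D f : \sum_v chip_value D f v <= deg D.
Proof.
rewrite deg_vertex_degree big_split big_split /= -addrA gerDl.
rewrite (exchange_big_dep predT) // [X in _ + X](exchange_big_dep predT) //=.
rewrite -big_split sumr_le0 // => e _.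
rewrite /= (big_pred1 (src e)) // (big_pred1 (tgt e)) //.
rewrite (_ : moment D e + _ - _ = - (f (tgt e) - f (src e) - moment D e)); last by ring.
by rewrite mulNr; have /andP[_] := floor_floorN ((f (tgt e) - f (src e) - moment D e) / len e).
Qed.

Lemma equiv_effective_deg D : equiv_effective D -> 0 <= deg D.
Proof.
move=> /equiv_effectiveP[f f0]; apply: le_trans (sum_chip_value D f).
exact: sumr_ge0.
Qed.

Lemma equiv_effectiveD D E : effective E -> equiv_effective D -> equiv_effective (D + E).
Proof.
move=> E0 [D' [D'0 [phi [rphi Dphi]]]]; exists (D' + E); split.
  by move=> p; rewrite coeffD addr_ge0.
by exists phi; split=> // p; rewrite opprD addrACA subrr addr0.
Qed.

(** The maximum in the rank is attained since [deg D] bounds it; an effective divisor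
    of degree [r] extends by copies of [p] to one of degree [rank D]. *)
Lemma rank_geP D (r : int) (p : point G) : 0 < r ->
  (r <= rank D <-> forall E, effective E -> deg E = r -> equiv_effective (D - E)).
Proof.
move=> r0; rewrite /rank.
pose pts k : divisor G := << k *g p >>.
have pts_eff k : 0 <= k -> effective (pts k).
  by move=> k0 q; rewrite coeffU mulr_ge0 // ler0n.
have deg_pts k : deg (pts k) = k by rewrite degU.
set A := (X in zmax X).
have A_deg s : A s -> s <= deg D.
  move=> [s0 /(_ (pts s) (pts_eff s s0) (deg_pts s)) /equiv_effective_deg].
  by rewrite degB deg_pts subr_ge0.
split=> [|H].
  case: ifPn => [/asboolP D_eff|_]; last by lia.
  have A0 : A 0.
    split=> // E E0 dE; rewrite (_ : E = 0) ?subr0 //.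
    by apply: fgpos_eq0P => //; apply/fgposP.
  have [[s0 sP] _] := zmax_attained A0 A_deg; move: (zmax A) s0 sP => s s0 sP rs E E0 dE.
  rewrite (_ : D - E = D - (E + pts (s - r)) + pts (s - r)); last first.
    by rewrite opprD addrA subrK.
  apply: equiv_effectiveD; first by apply: pts_eff; rewrite subr_ge0.
  apply: sP; last by rewrite degD deg_pts dE; ring.
  by move=> q; rewrite coeffD addr_ge0 // pts_eff // subr_ge0.
have D_eff : equiv_effective D.
  rewrite (_ : D = D - pts r + pts r); last by rewrite subrK.
  have pr := pts_eff r (ltW r0).
  by apply: equiv_effectiveD => //; apply: H.
rewrite ifT; last exact/asboolP.
have Ar : A r by split=> //; apply: ltW.
by have [_] := zmax_attained Ar A_deg; apply.
Qed.

End Rank.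

Section Kmn.
Variables (R : realType) (m n : nat).
Local Notation G := (Kmn R m n).
Local Notation V := ('I_m + 'I_n)%type.
Implicit Types (D E : divisor G).

(** The right vertices are the targets of the edges, hence the signs. *)
Definition twist D (v w : V) : R :=
  match v, w with
  | inl i, inr j => - moment D (i, j)
  | inr j, inl i => moment D (i, j)
  | _, _ => 0
  end.

Lemma twist_antisym D : antisym (twist D).
Proof. by move=> [i|j] [i'|j'] /=; rewrite ?oppr0 ?opprK. Qed.

Lemma chip_value_Kmn D f v :
  chip_value D f v = potential_value (@bipartite m n) (vertex_degree D) (twist D) f v.
Proof.
rewrite /chip_value /potential_value -addrA; congr (_ + _).
case: v => [i|j].
  rewrite [X in _ + X]big1 ?addr0 // big_bipartite_inl.
  transitivity (\sum_(i' | i' == i) \sum_(j : 'I_n) edge_floor (twist D) f (inl i') (inr j)).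
    rewrite pair_big; apply: eq_big => [e|e _]; first by rewrite andbT.
    by rewrite /edge_floor /= divr1; case: e => i' j /=; congr Num.floor; ring.
  by rewrite big_pred1_eq.
rewrite big1 ?add0r // big_bipartite_inr.
transitivity (\sum_(i : 'I_m) \sum_(j' | j' == j) edge_floor (twist D) f (inr j') (inl i)).
  rewrite pair_big; apply: eq_big => [e|e _]; first by [].
  by rewrite /edge_floor /= divr1; case: e => i j' /=; congr Num.floor; ring.
by apply: eq_bigr => i _; rewrite big_pred1_eq.
Qed.

Lemma equiv_effective_Kmn D : equiv_effective D <->
  exists f, forall v, 0 <= potential_value (@bipartite m n) (vertex_degree D) (twist D) f v.
Proof.
split=> [/equiv_effectiveP|] [f fP].
  by exists f => v; rewrite -chip_value_Kmn.
by apply/equiv_effectiveP; exists f => v; rewrite chip_value_Kmn.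
Qed.

Lemma vertex_degree_inl D i : vertex_degree D (inl i : vert G) =
  coeff (vpoint (inl i : vert G)) D + \sum_j edge_degree D ((i, j) : edge G).
Proof.
congr (_ + _); transitivity (\sum_(i' | i' == i) \sum_(j : 'I_n) edge_degree D ((i', j) : edge G)).
  by rewrite pair_big; apply: eq_big => [e|[i' j] _] //; rewrite andbT.
by rewrite big_pred1_eq.
Qed.

Lemma vertex_degree_inr D j :
  vertex_degree D (inr j : vert G) = coeff (vpoint (inr j : vert G)) D.
Proof. by rewrite /vertex_degree big1 ?addr0. Qed.

Lemma deg_vertex_divisor (c : vert G -> int) : deg (vertex_divisor c) = \sum_v c v.
Proof.
by rewrite deg_vertex_degree; apply: eq_bigr => v _; rewrite vertex_degree_vertex_divisor.
Qed.

Hypotheses (m0 : (0 < m)%N) (n0 : (0 < n)%N).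

Lemma rank_degree_bound D (r : nat) : (0 < r < m * n)%N -> r%:Z <= rank D ->
  exists p q : nat, [/\ (0 < p <= m)%N, (0 < q <= n)%N, (r < p * q)%N &
    (p%:Z - 1) * n%:Z + (q%:Z - 1) * m%:Z - (p%:Z * q%:Z - 1 - r%:Z) <= deg D].
Proof.
move=> /andP[r0 rmn]; have r0Z : 0 < r%:Z by rewrite ltz_nat.
move=> /(rank_geP D (vpoint (inl (Ordinal m0) : vert G)) r0Z) H.
rewrite deg_vertex_degree; apply: (degree_lower_bound m0 n0 rmn (twist_antisym D)).
move=> E sE; pose ED : divisor G := @vertex_divisor R G (fun v => (E v)%:Z).
have /equiv_effective_Kmn[f fP] : equiv_effective (D - ED).
  apply: H; first exact: vertex_divisor_effective.
  by rewrite deg_vertex_divisor -sE -[RHS]natz natr_sum; apply: eq_bigr => v _; rewrite natz.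
exists f => v; have := fP v; congr (is_true (_ <= potential_value _ _ _ _ _)).
  by apply/funext => u; rewrite vertex_degreeB vertex_degree_vertex_divisor.
apply/funext => -[i|j]; apply/funext => -[i'|j'] //=;
  by rewrite momentB moment_vertex_divisor subr0.
Qed.

(** The divisor has [b] chips on each left vertex and [a] on each right one, less [h]
    chips at [p0]; these are added to the effective divisor to be removed. *)
Lemma rank_grid (a b : nat) (h : int) : (a < m)%N -> 0 <= h ->
  0 < a.+1%:Z * b.+1%:Z - 1 - h ->
  exists D, deg D = a%:Z * n%:Z + b%:Z * m%:Z - h /\
    a.+1%:Z * b.+1%:Z - 1 - h <= rank D.
Proof.
move=> am h0 r0; pose p0 : point G := vpoint (inl (Ordinal m0) : vert G).
pose D0 : divisor G := @vertex_divisor R G (fun v => if v is inl _ then b%:Z else a%:Z).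
exists (D0 - << h *g p0 >>); split.
  rewrite degB degU deg_vertex_divisor sum_inl_inr !sumr_const !card_ord; ring.
apply/(rank_geP _ p0 r0) => E E0 dE.
pose E' := E + << h *g p0 >>.
rewrite (_ : D0 - _ - E = D0 - E'); last by rewrite opprD addrA addrAC.
have E'0 : effective E'.
  by move=> p; rewrite coeffD addr_ge0 // coeffU mulr_ge0 // ler0n.
have dE' : deg E' = a.+1%:Z * b.+1%:Z - 1 by rewrite degD degU dE; ring.
apply/equiv_effective_Kmn.
have [//|[f [Lf _]]] := dichotomy (vertex_degree (D0 - E')) m0 n0 (twist_antisym (D0 - E')).
exfalso; suff: a.+1%:Z * b.+1%:Z <= deg E' by rewrite dE'; lia.
have degE' : deg E' = \sum_i coeff (vpoint (inl i : vert G)) E'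
    + \sum_j coeff (vpoint (inr j : vert G)) E'
    + \sum_i \sum_j edge_degree E' ((i, j) : edge G).
  rewrite deg_vertex_degree sum_inl_inr (eq_bigr _ (fun i _ => vertex_degree_inl E' i)).
  by rewrite (eq_bigr _ (fun j _ => vertex_degree_inr E' j)) big_split /= addrAC.
rewrite degE'; apply: grid_degree (twist_antisym (D0 - E')) am _ _ _ _ _ Lf => // [i j|i|j].
- rewrite /= momentB moment_vertex_divisor sub0r opprK.
  by have := moment_bounds ((i, j) : edge G) E'0; rewrite mulr1.
- rewrite vertex_degreeB vertex_degree_vertex_divisor vertex_degree_inl; ring.
- by rewrite vertex_degreeB vertex_degree_vertex_divisor vertex_degree_inr.
Qed.

End Kmn.

Section DeltaGonality.
Variables (R : realType) (m n : nat) (m0 : (0 < m)%N) (n0 : (0 < n)%N) (r : int).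
Hypothesis r_range : 0 < r < (m%:Z - 1) * (n%:Z - 1).
Local Notation G := (Kmn R m n).

Lemma divisor_of_Iset a b h : Iset m n r (a, b, h) ->
  exists D : divisor G, deg D = a * n%:Z + b * m%:Z - h /\ r <= rank D.
Proof.
case=> /andP[a0 am] /andP[b0 bn] h0 rE.
case: a a0 am rE => // a _ am rE; case: b b0 bn rE => // b _ bn rE.
have {}rE : r = a.+1%:Z * b.+1%:Z - 1 - h by rewrite rE; lia.
have [|||D [dD rD]] := @rank_grid R m n m0 n0 a b h => //; try lia.
by exists D; rewrite dD rE.
Qed.

Lemma Iset_of_divisor (D : divisor G) : r <= rank D ->
  exists a b h, Iset m n r (a, b, h) /\ a * n%:Z + b * m%:Z - h <= deg D.
Proof.
move=> rD; have [r' rE] : exists r' : nat, r = r'%:Z by exists (absz r); lia.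
have r'mn : (0 < r' < m * n)%N by nia.
have := @rank_degree_bound R m n m0 n0 D r' r'mn; rewrite -rE => /(_ rD).
move=> [p [q [pm qn rpq d_ge]]].
exists (p%:Z - 1), (q%:Z - 1), (p%:Z * q%:Z - 1 - r); split; last exact: d_ge.
by split; rewrite ?subrK; nia.
Qed.

Lemma gonality_Kmn : gonality G r = delta r m n.
Proof.
rewrite /delta; set A := (X in _ = zmin X).
have A_full : A ((m%:Z - 1) * n%:Z + (n%:Z - 1) * m%:Z - (m%:Z * n%:Z - 1 - r)).
  exists (m%:Z - 1), (n%:Z - 1), (m%:Z * n%:Z - 1 - r); split=> //.
  by split; rewrite ?subrK; nia.
have A_lb d : A d -> - (m%:Z * n%:Z) <= d.
  move=> [a [b [h [[/andP[a0 am] /andP[b0 bn] h0 rE] ->]]]]; nia.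
have [Amin minA] := zmin_attained A_full A_lb.
apply: zmin_eq => [|d [D [<- rD]]].
  move: Amin => [a [b [h [/divisor_of_Iset[D [dD rD]] ->]]]].
  by exists D; split.
have [a [b [h [abh le]]]] := Iset_of_divisor rD.
by apply: le_trans le; apply: minA; exists a, b, h.
Qed.

End DeltaGonality.

Theorem theorem4 (R : realType) (m n : nat) (hm : (0 < m)%N) (hn : (0 < n)%N) :
  (genus (Kmn R m n))%:Z = (m%:Z - 1) * (n%:Z - 1) /\
  forall r : int, 0 < r < (genus (Kmn R m n))%:Z ->
    gonality (Kmn R m n) r = delta r m n.
Proof.
split; first exact: genus_Kmn.
by move=> r; rewrite genus_Kmn //; apply: gonality_Kmn.
Qed.
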